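(* Suppose assumptions (A1)–(A3) of the context hold, and let $\tilde\theta_{n+1}=\tilde\theta_n+\alpha_{n+1}[A\tilde\theta_n+\Delta_{n+1}]$, $n\ge0$. Suppose moreover that there is an eigenvalue $\lambda$ of $A$ that satisfies $-\varrho_0=\mathrm{Real}(\lambda)>-\tfrac12$, with corresponding left eigenvector $v\neq0$ ($v^{\top}A=\lambda v^{\top}$) satisfying $\Sigma_\Delta v\neq0$. Then $\mathsf E[\|\tilde\theta_n\|^2]$ converges to zero at rate no faster than $1/n^{2\varrho_0}$.
   Context: Let $\mathsf Z$ be a Polish space and $V:\mathsf Z\to[1,\infty)$ a measurable function. For measurable $g:\mathsf Z\to\mathbb R$ put $\|g\|_V=\sup_{z}|g(z)|/V(z)$, and let $L_\infty^V$ be the set of measurable $g$ with $\|g\|_V<\infty$. (A1) $\{\Phi_n\}_{n\ge0}$ is a time-homogeneous Markov chain on $\mathsf Z$ that is $V$-uniformly ergodic with unique invariant measure $\pi$: there are $\rho\in(0,1)$ and $B_V<\infty$ such that for all $g\in L_\infty^V$, $z\in\mathsf Z$, $n\ge 0$, $|\mathsf E[g(\Phi_n)\mid\Phi_0=z]-\pi(g)|\le B_V\|g\|_V\rho^nV(z)$. (A2) $A$ is a real $d\times d$ Hurwitz matrix (all eigenvalues have strictly negative real part), and $\alpha_n=1/n$ for $n\ge1$. (A3) $f^*:\mathsf Z\to\mathbb R^d$ is measurable with $\|(f_i^* )^2\|_V<\infty$ and $\pi(f_i^* )=0$ for each $i$. Put $\Delta_n=f^*(\Phi_n)$ and $\Sigma_\Delta=\sum_{k=-\infty}^{\infty}\mathsf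 E_\pi[\Delta_k\Delta_0^{\top}]$, where $\mathsf E_\pi$ is expectation for the (two-sided) stationary version of the chain. The initial condition $(\Phi_0,\tilde\theta_0)$ is fixed (deterministic). A deterministic sequence $\{e_n\}$ converges to zero at rate $1/n^{\varrho_1}$ if $\lim n^{\varrho}\|e_n\|=0$ for every $\varrho<\varrho_1$ and $\lim n^{\varrho}\|e_n\|=\infty$ for every $\varrho>\varrho_1$; accordingly, ''at rate no faster than $1/n^{\varrho_1}$'' means $\lim_{n\to\infty} n^{\varrho}\|e_n\|=\infty$ for every $\varrho>\varrho_1$. *)

(* Defs.v *)
From HB Require Import structures.
From mathcomp Require Import all_boot all_order all_algebra.
From mathcomp Require Import all_classical all_reals all_analysis.
From mathcomp Require Import complex.

Set Implicit Arguments.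
Unset Strict Implicit.
Unset Printing Implicit Defensive.
Import Order.TTheory GRing.Theory Num.Theory.
Import numFieldNormedType.Exports.

Local Open Scope classical_set_scope.
Local Open Scope ring_scope.

Definition polish (R : realType) (T : ptopologicalType) : Prop :=
  (exists2 S : set T, countable S & dense S) /\
  exists dist : T -> T -> R,
    [/\ forall x y, 0 <= dist x y,
        forall x y, dist x y = 0 <-> x = y,
        forall x y, dist x y = dist y x
      & forall x y z, dist x z <= dist x y + dist y z] /\
    [/\ forall (x : T) (N : set T), nbhs x N <->
          exists2 e, 0 < e & [set y | dist x y < e] `<=` N
      & forall u : nat -> T,
          (forall e, 0 < e -> exists N, forall m n,
             (N <= m)%N -> (N <= n)%N -> dist (u m) (u n) < e) ->
          exists l : T, u @ \oo --> l].

Notation borel Z := (g_sigma_algebraType (@open Z)).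

Section WeightedNorm.
Context {R : realType} {Z : ptopologicalType}.
Implicit Types (V g : Z -> R).

Definition normV V g : \bar R :=
  ereal_sup (range (fun z => (`|g z| / V z)%:E)).

Definition LinftyV V : set (Z -> R) :=
  [set g | measurable_fun [set: borel Z] g /\ (normV V g < +oo)%E].

End WeightedNorm.

Section Kernels.
Context {R : realType} {Z : ptopologicalType}.
Variable P : R.-pker (borel Z) ~> (borel Z).

Fixpoint kernel_iter (n : nat) : R.-spker (borel Z) ~> (borel Z) :=
  if n is m.+1 then mkcomp_noparam P (kernel_iter m)
  else kdirac (@measurable_id _ (borel Z) setT).

Definition invariant_measure (mu : probability (borel Z) R) : Prop :=
  forall B : set (borel Z), measurable B -> (\int[mu]_z (P z B) = mu B)%E.

(* The integrals and the bound live in the extended reals, where a non-integrable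
   [g] would make the left-hand side [+oo]; the bound therefore contains the
   integrability of every [g] in [LinftyV V]. *)
Definition V_uniformly_ergodic (V : Z -> R) (pi : probability (borel Z) R) :=
  [/\ invariant_measure pi,
      forall mu : probability (borel Z) R, invariant_measure mu ->
        forall B : set (borel Z), measurable B -> mu B = pi B
    & exists rho BV : R, 0 < rho < 1 /\
        forall g, LinftyV V g -> forall (z : Z) (n : nat),
          (`|(\int[kernel_iter n z]_y (g y)%:E) - (\int[pi]_y (g y)%:E)|
             <= BV%:E * normV V g * (rho ^+ n * V z)%:E)%E].

Section Chain.
Context {dO : measure_display} {Omega : measurableType dO}.
Variable Pr : probability Omega R.

Definition history (I : Type) (J : set I) (X : I -> Omega -> Z) :
    set (set Omega) :=
  <<s [set E | exists j (B : set (borel Z)),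
         [/\ J j, measurable B & E = X j @^-1` B]] >>.

(* P(X_(next n) in B | X_j, j <= n) = P(X_n, B), stated by integrating over
   the events of the past; used with [I] = nat and [I] = int. *)
Definition markov_chain {disp : Order.disp_t} {I : porderType disp}
    (next : I -> I) (X : I -> Omega -> Z) : Prop :=
  (forall n, measurable_fun [set: Omega] (X n : Omega -> borel Z)) /\
  forall n (B : set (borel Z)) (E : set Omega), measurable B ->
    history [set j | (j <= n)%O] X E ->
    (Pr (E `&` X (next n) @^-1` B) = \int[Pr]_(w in E) (P (X n w) B))%E.

Definition stationary_version (pi : probability (borel Z) R)
    (X : int -> Omega -> Z) : Prop :=
  markov_chain (fun k => k + 1) X /\
  forall (k : int) (B : set (borel Z)), measurable B -> Pr (X k @^-1` B) = pi B.

End Chain.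
End Kernels.

Section Covariance.
Context {R : realType} {Z : ptopologicalType} {d : nat}.
Context {dO : measure_display} {Omega : measurableType dO}.
Variables (Pr : probability Omega R) (X : int -> Omega -> Z).
Variable f : Z -> 'cV[R]_d.

Definition autocov (k : int) : 'M[R]_d :=
  \matrix_(i, j) fine 'E_Pr[fun w => (f (X k w) *m (f (X 0 w))^T) i j].

(* The two-sided series is the sum of its nonnegative and negative halves;
   both converge absolutely in the V-uniformly ergodic setting. *)
Definition asymptotic_cov : 'M[R]_d :=
  \matrix_(i, j)
    (limn (series (fun k : nat => autocov k%:Z i j)) +
     limn (series (fun k : nat => autocov (- k.+1%:Z) i j))).

End Covariance.

Section LinearSA.
Context {R : realType} {d : nat}.

Definition complexify {m n : nat} (M : 'M[R]_(m, n)) : 'M[R[i]]_(m, n) :=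
  map_mx (real_complex R) M.

Definition hurwitz (A : 'M[R]_d) : Prop :=
  forall l : R[i], eigenvalue (complexify A) l -> complex.Re l < 0.

Definition euclidean_norm (x : 'cV[R]_d) : R :=
  Num.sqrt (\sum_i x i 0 ^+ 2).

Definition step_size (n : nat) : R := n%:R^-1.

Fixpoint sa_iter (A : 'M[R]_d) (Delta : nat -> 'cV[R]_d) (theta0 : 'cV[R]_d)
    (n : nat) : 'cV[R]_d :=
  if n is m.+1 then
    let theta := sa_iter A Delta theta0 m in
    theta + step_size m.+1 *: (A *m theta + Delta m.+1)
  else theta0.

End LinearSA.

(* Extended-real valued, so that no finiteness of [e] is presupposed. *)
Definition cvg0_no_faster_than {R : realType} (e : nat -> \bar R) (r1 : R) :=
  e @ \oo --> 0%E /\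
  forall r, r1 < r -> (fun n => (n%:R `^ r)%:E * `|e n|)%E @ \oo --> +oo%E.

(* Main.v *)
Require Import Defs.
From HB Require Import structures.
From mathcomp Require Import all_boot all_order all_algebra.
From mathcomp Require Import all_classical all_reals all_analysis.
From mathcomp Require Import finmap measurable_realfun complex ring lra.
Import Order.TTheory GRing.Theory Num.Theory.
Import numFieldNormedType.Exports.
Local Open Scope classical_set_scope.
Local Open Scope ring_scope.

(** Write D_n = f(Phi_n), and let F = sum_k P^k f solve the Poisson equation
    F - P F = f, with H = F - f = P F. Then
    D_(n+1) = m_(n+1) + H(Phi_n) - H(Phi_(n+1)), where
    m_(n+1) = F(Phi_(n+1)) - H(Phi_n) is a martingale increment, and the corrected
    iterates c_n = theta_n + H(Phi_n)/n satisfy c_(n+1) = b_n + m_(n+1)/(n+1), where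
    b_n = (I + A/(n+1)) c_n + O(1/n^2) depends only on the past
    ([corrected_rec], [predictedE]). For every complex row vector u,
      E|u c_(n+1)|^2 = E|u b_n|^2 + E|u m_(n+1)|^2 / (n+1)^2,
    so the whole argument is about scalar recursions for s_n = E|u c_n|^2.

    Convergence to 0. If u A = l u + u' with Re l < 0, then u c_n is multiplied by
    1 + l/(n+1) at each step and receives the input (u' c_n)/(n+1); if
    E|u' c_n|^2 -> 0 then E|u c_n|^2 -> 0. By the Cayley-Hamilton theorem every u is
    killed by a product of factors A - l, over eigenvalues l, and an induction over
    this product treats all u ([msq_corrected_cvg0]).

    Lower bound. For u the given left eigenvector, E|u m_n|^2 tends to the value at u
    of the Hermitian form of Sigma. Summing the autocovariances gives
    Sigma_ij = pi(F_i F_j) - pi(H_i H_j), the stationary second moment of the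
    increments ([asymptotic_covE], [noise_moment_cvg]); thus Sigma is positive
    semidefinite and Sigma v <> 0 makes the limit positive ([quad_gt0]). As s_n -> 0,
    the O(1/n^2) perturbations of b_n are dominated by the injected noise, and
    eventually s_(n+1) >= (1 - 2 rho0/(n+1)) s_n + delta/(n+1)^2
    ([msq_corrected_lower]). Since 2 rho0 < 1, Bernoulli's inequality makes
    n^(2 rho0) s_n nondecreasing from then on ([powR_lower_recurrence]); it becomes
    positive and so stays away from 0. Passing from c_n back to theta_n costs
    O(1/n^2) in second moment.

    The Poisson solution must be square integrable along the chain, which needs
    geometric convergence in the weight sqrt V: it follows from V-uniform ergodicity
    by truncation ([sqrtV_decay]). *)

Set Implicit Arguments.
Unset Strict Implicit.

(** * Convergence and growth of real sequences *)

Section RealSequences.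
Context {R : realType}.
Implicit Types (u s : nat -> R).

Lemma cvg0_dominated u s : (\forall n \near \oo, `|u n| <= s n) ->
  s @ \oo --> (0 : R) -> u @ \oo --> (0 : R).
Proof.
move=> us s0; apply/norm_cvg0P.
apply: (@squeeze_cvgr _ _ _ _ (fun=> 0) s) => //.
  by near=> n; rewrite normr_ge0 /=; near: n.
exact: cvg_cst.
Unshelve. all: by end_near. Qed.

Lemma cvg_geometric_rate (c q l : R) u : 0 < q < 1 ->
  (forall n, `|l - u n| <= c * q ^+ n) -> u @ \oo --> l.
Proof.
move=> /andP[q0 q1] h.
have g0 : (fun n => c * q ^+ n) @ \oo --> (0 : R).
  by have := @cvg_geometric R c q; rewrite gtr0_norm//; exact.
have d0 : (fun n => l - u n) @ \oo --> (0 : R).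
  by apply: (cvg0_dominated _ g0); near=> n; exact: h.
have -> : u = fun n => l - (l - u n) by apply/funext => n; rewrite opprB addrC subrK.
by rewrite -[X in _ --> X]subr0; apply: cvgB => //; exact: cvg_cst.
Unshelve. all: by end_near. Qed.

Lemma eq0_geometric (c q x : R) : 0 < q < 1 ->
  (forall n, `|x| <= c * q ^+ n) -> x = 0.
Proof.
move=> q01 h.
have h1 : (fun=> 0 : R) @ \oo --> x.
  by apply: (@cvg_geometric_rate c q) => // n; rewrite subr0.
by rewrite -(cvg_lim _ h1)// lim_cst.
Qed.

Lemma geometric_series_tail (c q : R) u : 0 < q < 1 ->
  (forall n, `|u n| <= c * q ^+ n) ->
  forall n, `|limn (series u) - series u n| <= c / (1 - q) * q ^+ n.
Proof.
move=> /andP[q0 q1] h n.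
have d0 : 0 < 1 - q by rewrite subr_gt0.
have c0 : 0 <= c by have := le_trans (normr_ge0 _) (h 0%N); rewrite expr0 mulr1.
have cvu : cvgn (series u).
  apply: (@normed_cvg R R^o u); apply: (@series_le_cvg _ _ (geometric c q)).
  - by move=> k; exact: normr_ge0.
  - by move=> k; rewrite /geometric /= mulr_ge0// exprn_ge0// ltW.
  - by move=> k; exact: h.
  - by apply: is_cvg_geometric_series; rewrite gtr0_norm.
have diff m : `|series u (n + m)%N - series u n| <= c / (1 - q) * q ^+ n.
  apply: (@le_trans _ _ (c / (1 - q) * q ^+ n * (1 - q ^+ m))); last first.
    rewrite ler_piMr ?mulr_ge0 ?exprn_ge0 ?invr_ge0 ?(ltW d0) ?(ltW q0)//.
    by rewrite gerBl exprn_ge0 ?(ltW q0).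
  elim: m => [|m IH]; first by rewrite addn0 subrr normr0 expr0 subrr mulr0.
  rewrite addnS seriesSr addrAC (le_trans (ler_normD _ _))//.
  apply: le_trans (lerD IH (h _)) _.
  rewrite exprD exprS le_eqVlt; apply/orP; left; apply/eqP; field.
  by rewrite gt_eqF.
have cvd : (fun k => `|series u k - series u n|) @ \oo -->
    `|limn (series u) - series u n|.
  by apply: cvg_norm; apply: cvgB; [exact: cvu|exact: cvg_cst].
rewrite -(cvg_lim _ cvd)//; apply: limr_le; first by apply/cvg_ex; eexists; exact: cvd.
near=> k.
have nk : (n <= k)%N by near: k; exact: nbhs_infty_ge.
by rewrite -(subnKC nk).
Unshelve. all: by end_near. Qed.

Lemma cvgn_powR_pinfty (p : R) : 0 < p ->
  forall M : R, \forall n \near \oo, M <= n%:R `^ p.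
Proof.
move=> p0 M; near=> n.
apply: (@le_trans _ _ (Num.max M 1)); first by rewrite le_max lexx.
have M0 : 0 <= Num.max M 1 by rewrite le_max ler01 orbT.
have pn0 : p != 0 by rewrite gt_eqF.
have -> : Num.max M 1 = (Num.max M 1 `^ p^-1) `^ p.
  by rewrite -powRrM mulVf// powRr1.
apply: ge0_ler_powR; rewrite ?nnegrE ?powR_ge0 ?ler0n ?(ltW p0)//.
near: n; exact: nbhs_infty_ger.
Unshelve. all: by end_near. Qed.

(** With x = 1/(n+1): 1 - e x <= exp (- e x) <= (1 + x)^(-e). This is how a factor
    1 - e/n forces polynomial decay. *)
Lemma powR_contraction (e : R) n : 0 < e ->
  (n.+2)%:R `^ e * (1 - e / n.+1%:R) <= (n.+1)%:R `^ e.
Proof.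
move=> e0.
have n1 : 0 < n.+1%:R :> R by rewrite ltr0n.
have n2 : 0 < n.+2%:R :> R by rewrite ltr0n.
have lnle : ln (n.+2%:R) <= ln (n.+1%:R) + (n.+1%:R : R)^-1.
  rewrite -(subrK (n.+1%:R^-1) (ln n.+2%:R)) lerD2r.
  rewrite lerBlDr -lerBlDl -ln_div ?posrE//.
  have -> : n.+2%:R / n.+1%:R = 1 + n.+1%:R^-1 :> R.
    by rewrite -addn1 natrD mulrDl divff ?gt_eqF// mul1r.
  by apply: le_ln1Dx; rewrite (lt_trans (ltrN10 _))// invr_gt0.
rewrite /powR !gt_eqF//.
apply: (@le_trans _ _ (expR (e * ln n.+2%:R) * expR (- (e / n.+1%:R)))).
  by rewrite ler_wpM2l ?expR_ge0// expR_ge1Dx.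
rewrite -expRD ler_expR -mulrBr ler_wpM2l ?(ltW e0)//.
by rewrite lerBlDr.
Qed.

(** For any c > 0 the perturbation is eventually at most e c / (n+1), so that s - c
    obeys the unperturbed recursion: its positive part decays like n^(-e). *)
Lemma cvg0_contraction (e : R) s b : 0 < e -> b @ \oo --> (0 : R) ->
  (forall n, 0 <= s n) ->
  (\forall n \near \oo, s n.+1 <= (1 - e / n.+1%:R) * s n + b n / n.+1%:R) ->
  s @ \oo --> (0 : R).
Proof.
move=> e0 b0 s0 [N0 _ rec].
apply/cvgr0Pnorm_le => d d0.
have [N1 _ bN] : \forall n \near \oo, `|b n| <= e * (d / 2).
  by apply: (cvgr0_norm_le _ b0); rewrite mulr_gt0// divr_gt0.
pose N := maxn (maxn N0 N1) (Num.bound e).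
pose t n := Num.max (s n - d / 2) 0 * (n.+1%:R `^ e).
have nat0 n : 0 < n.+1%:R :> R by rewrite ltr0n.
have tmono n : (N <= n)%N -> t n.+1 <= t n.
  rewrite !geq_max => /andP[/andP[nN0 nN1] ne].
  have rn := rec n nN0.
  have bn := le_trans (ler_norm _) (bN n nN1).
  have c0 : 0 <= 1 - e / n.+1%:R.
    rewrite subr_ge0 ler_pdivrMr// mul1r.
    rewrite (le_trans (ltW (archi_boundP (ltW e0))))// ler_nat.
    exact: leq_trans ne (leqnSn n).
  have p1 : 0 <= n.+2%:R `^ e :> R by exact: powR_ge0.
  have stp : s n.+1 - d / 2 <= (1 - e / n.+1%:R) * (s n - d / 2).
    have bn' : b n / n.+1%:R <= e * (d / 2) / n.+1%:R.
      by rewrite ler_pM2r// invr_gt0.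
    apply: (@le_trans _ _ ((1 - e / n.+1%:R) * s n + e * (d / 2) / n.+1%:R - d / 2)).
      by rewrite lerD2r (le_trans rn)// lerD2l.
    by rewrite le_eqVlt; apply/orP; left; apply/eqP; ring.
  rewrite /t; apply: (@le_trans _ _ ((1 - e / n.+1%:R) *
      Num.max (s n - d / 2) 0 * n.+2%:R `^ e)).
    rewrite ler_wpM2r// ge_max; apply/andP; split.
      by rewrite (le_trans stp)// ler_wpM2l// le_max lexx.
    by rewrite mulr_ge0// le_max lexx orbT.
  rewrite mulrAC [X in _ <= X]mulrC ler_wpM2r ?le_max ?lexx ?orbT//.
  by rewrite mulrC powR_contraction.
have tbound n : (N <= n)%N -> t n <= t N.
  elim: n => [|n IH]; first by rewrite leqn0 => /eqP ->.
  rewrite leq_eqVlt => /predU1P[->//|]; rewrite ltnS => Nn.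
  exact: le_trans (tmono n Nn) (IH Nn).
have large := cvgn_powR_pinfty e0 (t N / (d / 2)).
near=> n.
have Nn : (N <= n)%N by near: n; exact: nbhs_infty_ge.
rewrite ger0_norm//.
have pn0 : 0 < n.+1%:R `^ e :> R by rewrite powR_gt0.
have le2 : Num.max (s n - d / 2) 0 <= d / 2.
  rewrite -(ler_pM2r pn0) (le_trans (tbound n Nn))// mulrC.
  rewrite -ler_pdivrMr ?divr_gt0//.
  apply: (@le_trans _ _ (n%:R `^ e)); first by near: n.
  by apply: ge0_ler_powR; rewrite ?nnegrE ?ler0n ?ler_nat// ltW.
move: le2; rewrite ge_max => /andP[+ _]; lra.
Unshelve. all: by end_near. Qed.

(** Weighted arithmetic-geometric mean of 1 - x and 1, with weights p and 1 - p. *)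
Lemma powR_bernoulli (p x : R) : 0 < p < 1 -> 0 <= x <= 1 ->
  (1 - x) `^ p <= 1 - p * x.
Proof.
move=> /andP[p0 p1] /andP[x0 x1].
have q0 : 0 < 1 - p by rewrite subr_gt0.
have := @conjugate_powR R ((1 - x) `^ p) 1 p^-1 (1 - p)^-1 (powR_ge0 _ _) ler01.
rewrite !invr_gt0 !invrK p0 q0 addrC subrK => /(_ isT isT erefl).
rewrite mulr1 -powRrM divff ?gt_eqF// powRr1 ?subr_ge0// powR1 mul1r.
move=> /le_trans; apply; rewrite le_eqVlt; apply/orP; left; apply/eqP; ring.
Qed.

(** By Bernoulli's inequality at x = 1/(n+1) the factor 1 - p/(n+1) is at least
    (n/(n+1))^p, so s n * n^p is nondecreasing. Here p < 1 is essential. *)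
Lemma powR_lower_recurrence (p : R) s N : 0 < p < 1 ->
  (forall n, (N <= n)%N -> (1 - p / n.+1%:R) * s n <= s n.+1) ->
  forall n, (N <= n)%N -> 0 <= s N -> s N * N%:R `^ p <= s n * n%:R `^ p.
Proof.
move=> p01 rec n Nn sN0; suff : 0 <= s n /\ s N * N%:R `^ p <= s n * n%:R `^ p.
  by case.
elim: n Nn => [|n IH]; first by rewrite leqn0 => /eqP <-.
rewrite leq_eqVlt => /predU1P[<-//|]; rewrite ltnS => Nn.
have [sn0 sNn] := IH Nn.
have n0 : 0 < n.+1%:R :> R by rewrite ltr0n.
have [p0 p1] := andP p01.
have c0 : 0 <= 1 - p / n.+1%:R.
  rewrite subr_ge0 ler_pdivrMr// mul1r (le_trans (ltW p1))// ler1n.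
  by [].
split; first by rewrite (le_trans _ (rec n Nn))// mulr_ge0.
apply: le_trans sNn _.
apply: (@le_trans _ _ ((1 - p / n.+1%:R) * s n * n.+1%:R `^ p)); last first.
  by rewrite ler_wpM2r ?powR_ge0// rec.
rewrite mulrAC mulrC ler_wpM2r//.
have r0 : 0 <= (n.+1%:R^-1 : R) <= 1.
  by rewrite invr_ge0 (ltW n0)/= invf_le1// ler1n.
have /andP[_ r1] := r0.
have -> : n%:R = (1 - n.+1%:R^-1) * n.+1%:R :> R.
  by rewrite mulrBl mulVf ?gt_eqF// mul1r -natr1 addrK.
rewrite powRM ?subr_ge0 ?(ltW n0)// ler_wpM2r ?powR_ge0//.
exact: powR_bernoulli.
Qed.

End RealSequences.

(** * Integration *)

Section MonotoneClass.
Local Open Scope ereal_scope.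
Context {d} {T : measurableType d} {R : realType}.
Import HBNNSimple.

(** The monotone class theorem in functional form: an identity between integrals
    extends from indicators to nonnegative functions. *)
Lemma ge0_measurable_fun_ind (Q : (T -> \bar R) -> Prop) :
  (forall A, measurable A -> Q (fun x => (\1_A x)%:E)) ->
  (forall f g : T -> \bar R, measurable_fun [set: T] f -> measurable_fun [set: T] g ->
     (forall x, 0 <= f x) -> (forall x, 0 <= g x) ->
     Q f -> Q g -> Q (f \+ g)) ->
  (forall (c : R) (f : T -> \bar R), (0 <= c)%R -> measurable_fun [set: T] f ->
     (forall x, 0 <= f x) -> Q f -> Q (fun x => c%:E * f x)) ->
  (forall f_ : (T -> \bar R)^nat, (forall n, measurable_fun [set: T] (f_ n)) ->
     (forall n x, 0 <= f_ n x) ->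
     (forall x, {homo f_ ^~ x : m n / (m <= n)%N >-> m <= n}) ->
     (forall n, Q (f_ n)) -> Q (fun x => limn (f_ ^~ x))) ->
  forall f : T -> \bar R, measurable_fun [set: T] f ->
    (forall x, 0 <= f x) -> Q f.
Proof.
move=> Q1 QD QZ Ql f mf f0.
have Q0 : Q (fun=> 0).
  have := Q1 set0 measurable0; congr (Q _).
  by apply/funext => x; rewrite indicE in_set0.
have Qsum (s : seq R) (F : R -> T -> \bar R) :
    (forall r, measurable_fun [set: T] (F r) /\ (forall x, 0 <= F r x)) ->
    (forall r, Q (F r)) -> Q (fun x => \sum_(r <- s) F r x).
  move=> mF QF; elim: s => [|r s IH].
    by move: Q0; congr (Q _); apply/funext => x; rewrite big_nil.
  rewrite (_ : (fun x => _) = F r \+ (fun x => \sum_(r <- s) F r x)).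
    apply: QD => //; first exact: (mF r).1.
    - by apply: emeasurable_sum => r'; exact: (mF r').1.
    - exact: (mF r).2.
    - by move=> x; apply: sume_ge0 => r' _; exact: (mF r').2.
  by apply/funext => x; rewrite big_cons.
pose f_ := nnsfun_approx measurableT mf.
have fnn n : Q (fun x => (f_ n x)%:E).
  pose F (r : R) := fun x : T => (Num.max r 0)%:E * (\1_(f_ n @^-1` [set r]) x)%:E.
  rewrite (_ : (fun x => _) =
    (fun x => \sum_(r <- fset_set (range (f_ n))) F r x)).
    apply: Qsum => r.
      split; first by apply: measurable_funeM; exact/measurable_EFinP.
      by move=> x; rewrite /F -EFinM lee_fin mulr_ge0// le_max lexx orbT.
    apply: QZ => //; first by rewrite le_max lexx orbT.
    - exact/measurable_EFinP.
    - exact: Q1.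
  apply/funext => x; rewrite {1}(fimfunE (f_ n)) -fsumEFin// fsbig_finite//=.
  rewrite big_seq [RHS]big_seq; apply: eq_bigr => r.
  rewrite in_fset_set; last exact: fimfunP. move=> /set_mem [y _ <-]. 
  by rewrite /F (max_idPl _)// fun_ge0.
rewrite (_ : f = fun x => limn (fun n => (f_ n x)%:E)).
  apply: Ql => //.
  - by move=> n; exact/measurable_EFinP.
  - by move=> n x; rewrite lee_fin.
  - by move=> x m n mn; rewrite lee_fin; exact/lefP/nd_nnsfun_approx.
by apply/funext => x; apply/esym/cvg_lim => //; exact: cvg_nnsfun_approx.
Qed.

End MonotoneClass.

Section Mixture.
Local Open Scope ereal_scope.
Context {d d'} {X : measurableType d} {Y : measurableType d'} {R : realType}.
Variables (mu : {measure set X -> \bar R}) (K : X -> {measure set Y -> \bar R}).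
Hypothesis mK : forall B, measurable B -> measurable_fun [set: X] (K ^~ B).

(** A measure that is a mixture on sets is one on functions, by the monotone class
    theorem; in particular integrals against composed kernels are iterated integrals. *)
Lemma ge0_integral_mixture (D : set X) (M : {measure set Y -> \bar R}) :
  measurable D ->
  (forall B, measurable B -> M B = \int[mu]_(x in D) K x B) ->
  forall f : Y -> \bar R, measurable_fun [set: Y] f -> (forall y, 0 <= f y) ->
  \int[M]_y f y = \int[mu]_(x in D) \int[K x]_y f y.
Proof.
move=> mD ME.
have mi (f : Y -> \bar R) : measurable_fun [set: Y] f -> (forall y, 0 <= f y) ->
    measurable_fun D (fun x => \int[K x]_y f y).
  move=> mf f0; apply: measurable_funTS.
  exact: measurable_fun_integral_kernel.
have ii (f : Y -> \bar R) x : (forall y, 0 <= f y) -> 0 <= \int[K x]_y f y.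
  by move=> f0; exact: integral_ge0.
apply: ge0_measurable_fun_ind.
- move=> A mA; rewrite integral_indic// setIT ME//.
  by apply: eq_integral => x _; rewrite integral_indic// setIT.
- move=> f g mf mg f0 g0 Ef Eg.
  rewrite (ge0_integralD M measurableT (fun y _ => f0 y) mf (fun y _ => g0 y) mg).
  rewrite Ef Eg -(ge0_integralD mu mD (fun x _ => ii f x f0) (mi f mf f0)
    (fun x _ => ii g x g0) (mi g mg g0)).
  apply: eq_integral => x _.
  by rewrite (ge0_integralD (K x) measurableT (fun y _ => f0 y) mf (fun y _ => g0 y) mg).
- move=> c f c0 mf f0 Ef.
  rewrite (ge0_integralZl_EFin M measurableT (fun y _ => f0 y) mf c0) Ef.
  rewrite -(ge0_integralZl_EFin mu mD (fun x _ => ii f x f0) (mi f mf f0) c0).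
  apply: eq_integral => x _.
  by rewrite (ge0_integralZl_EFin (K x) measurableT (fun y _ => f0 y) mf c0).
- move=> f_ mf f0 nd Ef; rewrite monotone_convergence//.
  rewrite (_ : (fun n => _) = (fun n => \int[mu]_(x in D) \int[K x]_y f_ n y)).
    rewrite -monotone_convergence//.
    + apply: eq_integral => x _; rewrite monotone_convergence//.
    + by move=> n; exact: mi.
    + by move=> n x _; exact: ii.
    + by move=> x _ m n mn; apply: ge0_le_integral => // y _; exact: nd.
  by apply/funext => n; exact: Ef.
Qed.

End Mixture.

Section SquareIntegrable.
Context {d} {T : measurableType d} {R : realType}.
Variable mu : {measure set T -> \bar R}.
Implicit Types X Y : T -> R.

Lemma Rintegral_sum (I : Type) (r : seq I) (F : I -> T -> R) :
  (forall i, mu.-integrable setT (EFin \o F i)) ->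
  mu.-integrable setT (EFin \o (fun w => \sum_(i <- r) F i w)) /\
  \int[mu]_w (\sum_(i <- r) F i w) = \sum_(i <- r) \int[mu]_w F i w.
Proof.
move=> iF; elim: r => [|i r [ir IH]].
  split.
    apply: (@eq_integrable _ _ _ mu setT measurableT (cst 0%E)).
      by move=> w _; rewrite /= big_nil.
    exact: integrable0.
  rewrite big_nil /Rintegral (eq_integral (cst 0%E)) ?integral0//.
  by move=> w _; rewrite big_nil.
have E : (fun w => \sum_(j <- i :: r) F j w) =
    (fun w => F i w + \sum_(j <- r) F j w).
  by apply/funext => w; rewrite big_cons.
rewrite E big_cons; split; first exact: (integrableD measurableT (iF i) ir).
by rewrite (RintegralD measurableT (iF i) ir) IH.
Qed.

Definition square_integrable X := measurable_fun [set: T] X /\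
  mu.-integrable setT (EFin \o (fun w => X w ^+ 2)).

Lemma square_integrable_mul X Y :
  square_integrable X -> square_integrable Y ->
  mu.-integrable setT (EFin \o (fun w => X w * Y w)).
Proof.
move=> [mX iX] [mY iY].
apply: (@le_integrable _ _ _ mu setT measurableT _
  (fun w => (X w ^+ 2)%:E + (Y w ^+ 2)%:E)%E).
- by apply/measurable_EFinP; exact: measurable_funM.
- move=> w _ /=; rewrite lee_fin [leRHS]ger0_norm ?addr_ge0 ?sqr_ge0// normrM.
  have := sqr_ge0 (`|X w| - `|Y w|).
  rewrite -(real_normK (num_real (X w))) -(real_normK (num_real (Y w))).
  have := normr_ge0 (X w); have := normr_ge0 (Y w).
  move: `|X w| `|Y w| => a b; nra.
- exact: integrableD.
Qed.

Lemma square_integrableZ a X :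
  square_integrable X -> square_integrable (fun w => a * X w).
Proof.
move=> [mX iX]; split; first exact: measurable_funM.
apply: (@eq_integrable _ _ _ mu setT measurableT
  (fun w => (a ^+ 2)%:E * (X w ^+ 2)%:E)%E).
  by move=> w _; rewrite -EFinM /= exprMn.
exact: integrableZl.
Qed.

Lemma square_integrableD X Y : square_integrable X -> square_integrable Y ->
  square_integrable (fun w => X w + Y w).
Proof.
move=> sX sY; have iXY := square_integrable_mul sX sY.
case: sX sY => [mX iX] [mY iY]; split; first exact: measurable_funD.
apply: (@eq_integrable _ _ _ mu setT measurableT
  (fun w => (X w ^+ 2)%:E + (2%:E * (X w * Y w)%:E + (Y w ^+ 2)%:E))%E).
  by move=> w _; rewrite -EFinM -!EFinD /=; congr _%:E; ring.
apply: integrableD => //; apply: integrableD => //.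
exact: integrableZl.
Qed.

Lemma square_integrable0 : square_integrable (fun=> 0).
Proof.
split; first exact: measurable_cst.
apply: (@eq_integrable _ _ _ mu setT measurableT (cst 0%E)).
  by move=> w _; rewrite /= expr0n.
exact: integrable0.
Qed.

Lemma square_integrable_sum (I : Type) (r : seq I) (F : I -> T -> R) :
  (forall i, square_integrable (F i)) ->
  square_integrable (fun w => \sum_(i <- r) F i w).
Proof.
move=> sF; elim: r => [|i r IH].
  rewrite (_ : (fun w => _) = (fun=> 0)); first exact: square_integrable0.
  by apply/funext => w; rewrite big_nil.
rewrite (_ : (fun w => _) = (fun w => F i w + \sum_(i <- r) F i w)).
  exact: square_integrableD.
by apply/funext => w; rewrite big_cons.
Qed.

End SquareIntegrable.

(** * V-uniform ergodicity and the Poisson equation *)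

Section KernelPowers.
Local Open Scope ereal_scope.
Context {R : realType} {Z : ptopologicalType}.
Variable P : R.-pker (borel Z) ~> (borel Z).
Implicit Types g : Z -> \bar R.

Lemma ge0_integral_kernel_iter0 g z : measurable_fun [set: borel Z] g ->
  \int[kernel_iter P 0 z]_y g y = g z.
Proof. by move=> mg; rewrite integral_dirac// diracT mul1e. Qed.

Lemma ge0_integral_kernel_iterS g z n : measurable_fun [set: borel Z] g ->
  (forall y, 0 <= g y) ->
  \int[kernel_iter P n.+1 z]_y g y = \int[P z]_y \int[kernel_iter P n y]_x g x.
Proof.
move=> mg g0; apply: ge0_integral_mixture => //.
by move=> B mB; exact: measurable_kernel.
Qed.

Lemma measurable_integral_kernel_iter g n : measurable_fun [set: borel Z] g ->
  (forall y, 0 <= g y) ->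
  measurable_fun [set: borel Z] (fun z => \int[kernel_iter P n z]_y g y).
Proof.
move=> mg g0; apply: measurable_fun_integral_kernel => // U mU.
exact: measurable_kernel.
Qed.

Lemma kernel_iter_le1 n z : kernel_iter P n z setT <= 1.
Proof. exact: sprob_kernel_le1. Qed.

End KernelPowers.

Section WeightedErgodicity.
Context {R : realType} {Z : ptopologicalType}.
Variables (P : R.-pker (borel Z) ~> (borel Z)) (V : Z -> R).
Variable pi : probability (borel Z) R.
Hypothesis mV : measurable_fun [set: borel Z] V.
Hypothesis V1 : forall z, 1 <= V z.
Hypothesis ergodic : V_uniformly_ergodic P V pi.

Let V0 z : 0 < V z. Proof. exact: lt_le_trans (V1 z). Qed.

(** Having norm at most [c] in the V-weighted supremum norm. *)
Definition V_bounded (c : R) (g : Z -> R) :=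
  [/\ 0 <= c, measurable_fun [set: borel Z] g & forall z, `|g z| <= c * V z].

Lemma normV_le c g : V_bounded c g -> (normV V g <= c%:E)%E.
Proof.
move=> [c0 _ gc]; apply: ub_ereal_sup => _ [z _ <-].
by rewrite lee_fin ler_pdivrMr.
Qed.

Lemma V_bounded_normV g : measurable_fun [set: borel Z] g ->
  (normV V g < +oo)%E -> exists c, V_bounded c g.
Proof.
move=> mg fin.
have ub z : ((`|g z| / V z)%:E <= normV V g)%E.
  by apply: ereal_sup_ubound; exists z.
have n0 : (0 <= normV V g)%E.
  by apply: le_trans (ub point); rewrite lee_fin divr_ge0// ltW.
have nfin : normV V g \is a fin_num by rewrite ge0_fin_numE.
exists (fine (normV V g)); split => //; first exact: fine_ge0.
by move=> z; have := ub z; rewrite -{1}(fineK nfin) lee_fin ler_pdivrMr.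
Qed.

Lemma V_bounded_abs c g : V_bounded c g -> V_bounded c (fun z => `|g z|).
Proof.
move=> [c0 mg gc]; split => //; first exact: measurableT_comp.
by move=> z; rewrite normr_id.
Qed.

Lemma V_bounded_V : V_bounded 1 V.
Proof. by split => // z; rewrite mul1r gtr0_norm. Qed.

Lemma V_boundedD c c' g g' : V_bounded c g -> V_bounded c' g' ->
  V_bounded (c + c') (fun z => g z + g' z).
Proof.
move=> [c0 mg gc] [c0' mg' gc']; split; first exact: addr_ge0.
  exact: measurable_funD.
by move=> z; rewrite mulrDl (le_trans (ler_normD _ _))// lerD.
Qed.

(** The ergodicity bound applied to the absolute value of [g]: since it lives in the
    extended reals and its right-hand side is finite, neither integral is infinite. *)
Lemma V_bounded_integrable c g n z : V_bounded c g ->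
  (kernel_iter P n z).-integrable setT (EFin \o g) /\
  pi.-integrable setT (EFin \o g).
Proof.
move=> /[dup] -[c0 mg gc] /V_bounded_abs bg.
have [_ _ [rho [BV [_ erg]]]] := ergodic.
have bn := normV_le bg; have [_ mag _] := bg.
have n0 : (0 <= normV V (fun z => `|g z|%R))%E.
  apply: le_trans (ereal_sup_ubound _); last by exists point.
  by rewrite lee_fin divr_ge0// ltW.
have nfin : (normV V (fun z => `|g z|%R) < +oo)%E by exact: le_lt_trans bn (ltry _).
have /= := erg _ (conj mag nfin) z n.
move: nfin; rewrite -ge0_fin_numE// => /fineK <-.
rewrite -!EFinM => le_fin.
set I := (\int[kernel_iter P n z]_y _)%E in le_fin.
set J := (\int[pi]_y _)%E in le_fin.
have I0 : (0 <= I)%E by apply: integral_ge0 => y _; rewrite lee_fin.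
have J0 : (0 <= J)%E by apply: integral_ge0 => y _; rewrite lee_fin.
have [Ifin Jfin] : (I < +oo)%E /\ (J < +oo)%E.
  move: le_fin I0 J0; clear; case: I => [i| |]//; case: J => [j| |]//=.
  by move=> *; split; exact: ltry.
by split; apply/integrableP; split => //; exact/measurable_EFinP.
Qed.

(** The n-step transition operator, acting on functions. *)
Definition Pn n (g : Z -> R) z : R := \int[kernel_iter P n z]_y g y.

Lemma V_uniform_rate : exists2 rho : R, 0 < rho < 1 & exists2 B : R, 0 <= B &
  forall c g, V_bounded c g -> forall n z,
    `|Pn n g z - \int[pi]_y g y| <= B * c * rho ^+ n * V z.
Proof.
have [_ _ [rho [BV [rho01 erg]]]] := ergodic.
exists rho => //; exists (Num.max BV 0); first by rewrite le_max lexx orbT.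
move=> c g bg n z; have [c0 mg gc] := bg.
have bn := normV_le bg.
have [ik ip] := V_bounded_integrable n z bg.
have n0 : (0 <= normV V g)%E.
  apply: le_trans (ereal_sup_ubound _); last by exists point.
  by rewrite lee_fin divr_ge0// ltW.
have /= := erg g (conj mg (le_lt_trans bn (ltry _))) z n.
rewrite -(fineK (integrable_fin_num measurableT ik)).
rewrite -(fineK (integrable_fin_num measurableT ip)).
have nfin : normV V g \is a fin_num.
  by rewrite ge0_fin_numE//; exact: le_lt_trans bn (ltry _).
rewrite -(fineK nfin) -EFinB abse_EFin -!EFinM lee_fin => /le_trans; apply.
have r0 : 0 <= rho ^+ n * V z.
  by rewrite mulr_ge0// ?ltW// exprn_gt0//; case/andP: rho01.
rewrite -[leRHS]mulrA ler_wpM2r//.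
have f0 : 0 <= fine (normV V g) by exact: fine_ge0.
have fc : fine (normV V g) <= c by rewrite -lee_fin fineK.
apply: (@le_trans _ _ (Num.max BV 0 * fine (normV V g))).
  by rewrite ler_wpM2r// le_max lexx.
by rewrite ler_wpM2l// le_max lexx orbT.
Qed.

Lemma V_bounded_integrable_P c g z : V_bounded c g ->
  (P z).-integrable setT (EFin \o g).
Proof.
move=> bg; have [c0 mg gc] := bg; apply/integrableP; split.
  exact/measurable_EFinP.
have [/integrableP[_ +] _] := V_bounded_integrable 1 z bg.
congr (_ < _)%E.
have mag : measurable_fun [set: borel Z] (fun y => `|(g y)%:E|)%E.
  by apply: measurableT_comp => //; exact/measurable_EFinP.
rewrite (ge0_integral_kernel_iterS P z 0 mag)//.
by apply: eq_integral => y _; rewrite ge0_integral_kernel_iter0.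
Qed.

Lemma Pn0 c g z : V_bounded c g -> Pn 0 g z = g z.
Proof.
move=> [_ mg _]; rewrite /Pn /Rintegral ge0_integral_kernel_iter0//.
exact/measurable_EFinP.
Qed.

Lemma PnB c c' g g' n z : V_bounded c g -> V_bounded c' g' ->
  Pn n (fun y => g y - g' y) z = Pn n g z - Pn n g' z.
Proof.
move=> /(V_bounded_integrable n z)[bg _] /(V_bounded_integrable n z)[bg' _].
by rewrite /Pn RintegralB.
Qed.

Lemma V_bounded_pos c g : V_bounded c g -> V_bounded c (fun z => Num.max (g z) 0).
Proof.
move=> [c0 mg gc]; split => //; first exact: measurable_maxr.
move=> z; apply: le_trans (gc z); rewrite /Num.max; case: ifP => // _.
by rewrite normr0.
Qed.

Lemma V_bounded_neg c g : V_bounded c g -> V_bounded c (fun z => Num.max (- g z) 0).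
Proof.
move=> [c0 mg gc]; apply: (@V_bounded_pos c (fun z => - g z)); split => //.
  exact: measurableT_comp.
by move=> z; rewrite normrN.
Qed.

Lemma maxr_posneg (x : R) : x = Num.max x 0 - Num.max (- x) 0.
Proof.
by rewrite /Num.max; case: ifPn => h1; case: ifPn => h2; move: h1 h2;
  rewrite -?leNgt; lra.
Qed.

Lemma V_bounded_Pn c g n : V_bounded c g -> exists c', V_bounded c' (Pn n g).
Proof.
have ge0 c1 g1 : V_bounded c1 g1 -> (forall z, 0 <= g1 z) ->
    measurable_fun [set: borel Z] (Pn n g1).
  move=> [_ mg1 _] g10; apply: (measurableT_comp (@fine_measurable R _ measurableT)).
  apply: measurable_integral_kernel_iter.
    exact/measurable_EFinP.
  by move=> y; rewrite lee_fin.
move=> bg; have [c0 mg gc] := bg.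
have [rho rho01 [B B0 rate]] := V_uniform_rate.
exists (`|\int[pi]_y g y| + B * c); split.
- by rewrite addr_ge0// mulr_ge0.
- have -> : Pn n g = fun z => Pn n (fun z => Num.max (g z) 0) z
      - Pn n (fun z => Num.max (- g z) 0) z.
    apply/funext => z; rewrite -(PnB _ _ (V_bounded_pos bg) (V_bounded_neg bg)).
    by congr Pn; apply/funext => y; exact: maxr_posneg.
  apply: measurable_funB; apply: ge0.
  + exact: V_bounded_pos bg.
  + by move=> z; rewrite le_max lexx orbT.
  + exact: V_bounded_neg bg.
  + by move=> z; rewrite le_max lexx orbT.
- move=> z; rewrite -(subrK (\int[pi]_y g y) (Pn n g z)).
  rewrite (le_trans (ler_normD _ _))// addrC mulrDl lerD//.
    by rewrite ler_peMr.
  apply: le_trans (rate _ _ bg n z) _; rewrite ler_wpM2r ?(ltW (V0 z))//.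
  rewrite ler_piMr ?mulr_ge0// exprn_ile1//; lra.
Qed.

Lemma PnS c g n z : V_bounded c g -> Pn n.+1 g z = \int[P z]_y Pn n g y.
Proof.
have ge0 c1 g1 : V_bounded c1 g1 -> (forall z, 0 <= g1 z) ->
    Pn n.+1 g1 z = \int[P z]_y Pn n g1 y.
  move=> bg1 g10; have [_ mg1 _] := bg1.
  rewrite /Pn /Rintegral (ge0_integral_kernel_iterS P z n (g := EFin \o g1)).
  - congr fine; apply: eq_integral => y _ /=.
    rewrite fineK//.
    by apply: integrable_fin_num => //; exact: (V_bounded_integrable n y bg1).1.
  - exact/measurable_EFinP.
  - by move=> y; rewrite lee_fin.
move=> bg; have bp := V_bounded_pos bg; have bn := V_bounded_neg bg.
have gE : g = fun z => Num.max (g z) 0 - Num.max (- g z) 0.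
  by apply/funext => y; exact: maxr_posneg.
have [cp bpn] := V_bounded_Pn n bp; have [cn bnn] := V_bounded_Pn n bn.
rewrite {1}gE (PnB _ _ bp bn) (ge0 _ _ bp) ?(ge0 _ _ bn)//.
- rewrite -RintegralB//; last 2 first.
  + exact: V_bounded_integrable_P bpn.
  + exact: V_bounded_integrable_P bnn.
  by apply: eq_Rintegral => y _; rewrite -(PnB _ _ bp bn) -gE.
- by move=> y; rewrite le_max lexx orbT.
- by move=> y; rewrite le_max lexx orbT.
Qed.

(** The functions whose square is bounded by a multiple of V. For them products are
    V-bounded, so that states of the chain give square integrable variables. *)
Definition sqrtV_bounded (K : R) (g : Z -> R) :=
  [/\ 0 <= K, measurable_fun [set: borel Z] g &
      forall z, `|g z| <= K * Num.sqrt (V z)].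

Let sV1 z : 1 <= Num.sqrt (V z).
Proof. by rewrite -sqrtr1 ler_wsqrtr. Qed.

Let sVle z : Num.sqrt (V z) <= V z.
Proof.
by rewrite -{2}(sqr_sqrtr (ltW (V0 z))) expr2 ler_peMr.
Qed.

Lemma sqrtV_bounded_V K g : sqrtV_bounded K g -> V_bounded K g.
Proof.
move=> [K0 mg gK]; split => // z; apply: le_trans (gK z) _.
by rewrite ler_wpM2l.
Qed.

Lemma sqrtV_boundedM K K' g g' : sqrtV_bounded K g -> sqrtV_bounded K' g' ->
  V_bounded (K * K') (fun z => g z * g' z).
Proof.
move=> [K0 mg gK] [K0' mg' gK']; split; first exact: mulr_ge0.
  exact: measurable_funM.
move=> z; rewrite normrM -(sqr_sqrtr (ltW (V0 z))) expr2 mulrACA.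
by rewrite ler_pM.
Qed.

Lemma sqrtV_boundedB K K' g g' : sqrtV_bounded K g -> sqrtV_bounded K' g' ->
  sqrtV_bounded (K + K') (fun z => g z - g' z).
Proof.
move=> [K0 mg gK] [K0' mg' gK']; split; first exact: addr_ge0.
  exact: measurable_funB.
by move=> z; rewrite mulrDl (le_trans (ler_normB _ _))// lerD.
Qed.

Lemma normV_sqrtV_bounded (g : Z -> R) : measurable_fun [set: borel Z] g ->
  (normV V (fun z => (g z ^+ 2)%R) < +oo)%E -> exists K, sqrtV_bounded K g.
Proof.
move=> mg fin.
have mg2 : measurable_fun [set: borel Z] (fun z => g z ^+ 2).
  exact: measurable_funX.
have [c [c0 _ gc]] := V_bounded_normV mg2 fin.
exists (Num.sqrt c); split => // z.
by rewrite -sqrtrM// -sqrtr_sqr ler_wsqrtr// (le_trans _ (gc z))// ler_norm.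
Qed.

(** V-uniform ergodicity passes to the weight sqrt V, at rate q = sqrt rho. Clip [g]
    at the level K q^n sqrt(V z): the bounded part contributes at most twice that
    level, and the rest is at most (K/L) V with L = q^n sqrt(V z), so it decays like
    rho^n V(z) K / L = K q^n sqrt(V z). *)
Lemma sqrtV_decay : exists2 q : R, 0 < q < 1 &
  forall K g, sqrtV_bounded K g -> \int[pi]_y g y = 0 ->
  exists2 C : R, 0 <= C & forall n, sqrtV_bounded (C * q ^+ n) (Pn n g).
Proof.
have [rho rho01 [B B0 rate]] := V_uniform_rate.
have q0 : 0 < Num.sqrt rho by rewrite sqrtr_gt0; lra.
have q2 : Num.sqrt rho ^+ 2 = rho by rewrite sqr_sqrtr//; lra.
(* q < 1 follows from q^2 = rho < 1 *)
exists (Num.sqrt rho); first by rewrite q0/=; move: q0 q2 rho01; nra.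
set q := Num.sqrt rho in q0 q2 *.
move=> K g sg pig0; have [K0 mg gK] := sg.
exists (K * (B + 2)); first by rewrite mulr_ge0// addr_ge0.
move=> n; have [c' [_ mPn _]] := V_bounded_Pn n (sqrtV_bounded_V sg).
split => //; first by rewrite mulr_ge0 ?exprn_ge0 ?mulr_ge0 ?addr_ge0 ?(ltW q0).
move=> z; set L := q ^+ n * Num.sqrt (V z).
have sV0 y : 0 < Num.sqrt (V y) by rewrite sqrtr_gt0.
have L0 : 0 < L by rewrite mulr_gt0 ?exprn_gt0.
have KL0 : 0 <= K * L by rewrite mulr_ge0// ltW.
pose g1 y := Num.max (Num.min (g y) (K * L)) (- (K * L)).
have mg1 : measurable_fun [set: borel Z] g1.
  by apply: measurable_maxr => //; exact: measurable_minr.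
have g1L y : `|g1 y| <= K * L.
  by rewrite ler_norml /g1; case: (leP (g y)); case: (leP _ (- (K * L))); lra.
have bg1 : V_bounded (K * L) g1.
  split => // y; apply: le_trans (g1L y) _.
  by rewrite ler_peMr.
have bg2 : V_bounded (K / L) (fun y => g y - g1 y).
  split; first by rewrite divr_ge0// ltW.
    exact: measurable_funB.
  move=> y; have [small|big] := leP `|g y| (K * L).
    rewrite (_ : g y - g1 y = 0) ?normr0.
      by rewrite mulr_ge0 ?divr_ge0 ?(ltW (V0 y)) ?(ltW L0).
    move: small; rewrite ler_norml /g1 => /andP[? ?].
    by rewrite (min_idPl _)// (max_idPl _) ?subrr.
  have big2 : K * L < K * Num.sqrt (V y) by exact: lt_le_trans big (gK y).
  have Kp : 0 < K.
    by rewrite lt_neqAle K0 andbT; apply: contraTN big2 => /eqP <-; rewrite !mul0r ltxx.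
  have LV : L <= Num.sqrt (V y) by rewrite ltW// -(ltr_pM2l Kp).
  apply: (@le_trans _ _ `|g y|).
    move: big; rewrite lter_normr /g1 /Num.max /Num.min ler_norml.
    have := ler_norm (g y); have := ler_norm (- g y); rewrite normrN.
    by do 2 case: ifPn; rewrite -?leNgt; move: `|g y| => a; lra.
  apply: le_trans (gK y) _; rewrite -mulrA ler_wpM2l//.
  rewrite mulrC ler_pdivlMr// -{2}(sqr_sqrtr (ltW (V0 y))) expr2.
  by rewrite ler_wpM2l// ltW.
have E1 := PnB n z (sqrtV_bounded_V sg) bg1.
have [i1 j1] := V_bounded_integrable n z bg1.
have [_ jg] := V_bounded_integrable n z (sqrtV_bounded_V sg).
have r2 := rate _ _ bg2 n z.
have bcst : V_bounded (K * L) (cst (K * L)).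
  by split => // y; rewrite ger0_norm// ler_peMr.
have [icst jcst] := V_bounded_integrable n z bcst.
have P1 : `|Pn n g1 z| <= K * L.
  apply: le_trans (le_normr_Rintegral _ i1) _ => //.
  apply: (@le_trans _ _ (\int[kernel_iter P n z]_y (K * L))).
    by apply: le_Rintegral => //; exact: integrable_norm i1.
  rewrite Rintegral_cst// ler_piMr//.
  rewrite -lee_fin fineK; first exact: kernel_iter_le1.
  rewrite ge0_fin_numE//; apply: le_lt_trans (kernel_iter_le1 P n z) _.
  exact: ltry.
have P2 : `|\int[pi]_y g1 y| <= K * L.
  apply: le_trans (le_normr_Rintegral _ j1) _ => //.
  apply: (@le_trans _ _ (\int[pi]_y (K * L))).
    by apply: le_Rintegral => //; exact: integrable_norm j1.
  rewrite Rintegral_cst// [X in fine X](_ : _ = 1%E) ?mulr1//.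
  exact: probability_setT.
have r3 : B * (K / L) * rho ^+ n * V z = B * K * L.
  rewrite -q2 exprAC -{1}(sqr_sqrtr (ltW (V0 z))) /L; field.
  by rewrite !gt_eqF ?exprn_gt0.
move: r2; rewrite E1 RintegralB// pig0 r3 sub0r opprK => r2.
rewrite -[leRHS]mulrA -/L.
apply: (@le_trans _ _ (`|Pn n g z - Pn n g1 z + \int[pi]_y g1 y| +
    (`|Pn n g1 z| + `|\int[pi]_y g1 y|))).
  rewrite -[X in `|X| <= _](_ : (Pn n g z - Pn n g1 z + \int[pi]_y g1 y) +
    (Pn n g1 z - \int[pi]_y g1 y) = _); last by ring.
  by rewrite (le_trans (ler_normD _ _))// lerD2l ler_normB.
apply: le_trans (lerD r2 (lerD P1 P2)) _.
rewrite le_eqVlt; apply/orP; left; apply/eqP; ring.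
Qed.

Lemma V_bounded_sum (I : Type) (r : seq I) (F : I -> Z -> R) :
  (forall i, exists c, V_bounded c (F i)) ->
  exists c, V_bounded c (fun z => \sum_(i <- r) F i z).
Proof.
move=> bF; elim: r => [|i r [c bc]].
  exists 0; split => //.
    by under eq_fun do rewrite big_nil; exact: measurable_cst.
  by move=> z; rewrite big_nil normr0 mul0r.
have [c' bc'] := bF i; exists (c' + c).
by under eq_fun do rewrite big_cons; exact: V_boundedD.
Qed.

Lemma le_Rintegral_V (mu : {measure set (borel Z) -> \bar R}) c g :
  mu.-integrable setT (EFin \o V) -> mu.-integrable setT (EFin \o g) ->
  V_bounded c g -> `|\int[mu]_z g z| <= c * \int[mu]_z V z.
Proof.
move=> imV ig [_ _ gc]; rewrite (le_trans (le_normr_Rintegral _ ig))//.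
rewrite -RintegralZl//; apply: le_Rintegral => //.
- exact: integrable_norm ig.
- exact: (@integrableZl _ _ _ _ _ measurableT c _ imV).
Qed.

(** The solution F = sum_k P^k g of F - P F = g. *)
Definition poisson (g : Z -> R) z : R := limn (series (fun k => Pn k g z)).

(** Geometric decay of P^k g gives a geometric tail; the case N = 0 bounds F itself. *)
Lemma poisson_tail : exists2 q : R, 0 < q < 1 &
  forall K g, sqrtV_bounded K g -> \int[pi]_y g y = 0 ->
  exists C : R, forall N, sqrtV_bounded (C * q ^+ N)
    (fun z => poisson g z - series (fun k => Pn k g z) N).
Proof.
have [q q01 decay] := sqrtV_decay; exists q => // K g sg pig0.
have [q0 q1] := andP q01; have d0 : 0 < 1 - q by rewrite subr_gt0.
have [C C0 dec] := decay K g sg pig0.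
have bnd z N : `|poisson g z - series (fun k => Pn k g z) N| <=
    C / (1 - q) * q ^+ N * Num.sqrt (V z).
  rewrite (mulrAC _ (q ^+ N)) (mulrAC C).
  apply: geometric_series_tail => // n; rewrite mulrAC.
  by have [_ _] := dec n; exact.
exists (C / (1 - q)) => N; split.
- by rewrite !mulr_ge0// ?exprn_ge0 ?invr_ge0 ?ltW.
- have [c [_ mS _]] := V_bounded_sum (index_iota 0 N)
    (fun k => V_bounded_Pn k (sqrtV_bounded_V sg)).
  apply: measurable_funB => //.
  apply: (@measurable_fun_cvg _ _ _ _ (fun N z => series (fun k => Pn k g z) N)).
    by move=> m; have [? []] := V_bounded_sum (index_iota 0 m)
      (fun k => V_bounded_Pn k (sqrtV_bounded_V sg)).
  move=> z _; apply: (@cvg_geometric_rate _ (C / (1 - q) * Num.sqrt (V z)) q) => //.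
  by move=> n; rewrite mulrAC; exact: bnd.
- by move=> z; exact: bnd.
Qed.

Lemma sqrtV_bounded_poisson K g : sqrtV_bounded K g -> \int[pi]_y g y = 0 ->
  exists C, sqrtV_bounded C (poisson g).
Proof.
have [q _ tail] := poisson_tail => sg pig0.
have [C /(_ 0%N)] := tail K g sg pig0; rewrite expr0 mulr1 => h; exists C.
congr (sqrtV_bounded _ _): h; apply/funext => z.
by rewrite /series /= big_geq// subr0.
Qed.

(** P maps the partial sum of order N to the one of order N+1 without its first term
    [g]; the remainders vanish geometrically. *)
Lemma poisson_equation K g : sqrtV_bounded K g -> \int[pi]_y g y = 0 ->
  forall z, \int[P z]_y poisson g y = poisson g z - g z.
Proof.
move=> sg pig0 z; have bg := sqrtV_bounded_V sg.
have [q q01 tail] := poisson_tail.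
have [C tailC] := tail K g sg pig0.
have [D /sqrtV_bounded_V bp] := sqrtV_bounded_poisson sg pig0.
apply/eqP; rewrite -subr_eq0; apply/eqP.
pose M := \int[P z]_y V y.
have [q0 q1] := andP q01.
apply: (@eq0_geometric _ (C * M + C * Num.sqrt (V z)) q _ q01) => N.
have tN := tailC N; have /sqrtV_bounded_V btN := tN.
have iS k : (P z).-integrable setT (EFin \o Pn k g).
  by have [c /V_bounded_integrable_P] := V_bounded_Pn k bg; exact.
have [iSN SN] : (P z).-integrable setT
    (EFin \o (fun y => series (fun k => Pn k g y) N)) /\
    \int[P z]_y series (fun k => Pn k g y) N = \sum_(0 <= k < N) \int[P z]_y Pn k g y.
  exact: Rintegral_sum.
have imV := V_bounded_integrable_P z V_bounded_V.
have := le_Rintegral_V imV (V_bounded_integrable_P z btN) btN.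
rewrite RintegralB//; last exact: V_bounded_integrable_P bp.
rewrite SN => h1.
have [_ _ /(_ z)] := tailC N.+1.
rewrite [series _ N.+1]/series /= big_nat_recl// (Pn0 _ bg) => h2.
have SE : \sum_(0 <= k < N) \int[P z]_y Pn k g y = \sum_(0 <= i < N) Pn i.+1 g z.
  by apply: eq_bigr => k _; rewrite (PnS _ _ bg).
rewrite SE in h1.
set S := \sum_(0 <= i < N) _ in h1 h2.
rewrite (_ : _ - _ = (\int[P z]_y poisson g y - S) - (poisson g z - (g z + S))); last by ring.
rewrite (le_trans (ler_normB _ _))// mulrDl lerD//.
  by rewrite mulrAC.
apply: le_trans h2 _.
rewrite [leLHS](_ : _ = q * (C * q ^+ N * Num.sqrt (V z))); last by rewrite exprS; ring.
rewrite [leRHS]mulrAC ler_piMl ?(ltW q1)//.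
by have [CN0 _ _] := tN; rewrite mulr_ge0.
Qed.

Lemma poisson_pi K K' g h : sqrtV_bounded K g -> \int[pi]_y g y = 0 ->
  sqrtV_bounded K' h ->
  series (fun k => \int[pi]_z (h z * Pn k g z)) @ \oo -->
    \int[pi]_z (h z * poisson g z).
Proof.
move=> sg pig0 sh; have bg := sqrtV_bounded_V sg.
have [q q01 tail] := poisson_tail.
have [C tailC] := tail K g sg pig0.
have [D sp] := sqrtV_bounded_poisson sg pig0.
apply: (@cvg_geometric_rate _ (K' * C * \int[pi]_y V y) q) => // N.
have bd := sqrtV_boundedM sh (tailC N).
have [_ ipV] := V_bounded_integrable 0 point V_bounded_V.
have [_ ibd] := V_bounded_integrable 0 point bd.
have := le_Rintegral_V ipV ibd bd.
have [D' sh'] := V_bounded_sum (index_iota 0 N)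
  (fun k => V_bounded_Pn k (sqrtV_bounded_V sg)).
have bhk k : exists c, V_bounded c (fun z => h z * Pn k g z).
  have [q' _ decay] := sqrtV_decay.
  have [C' _ /(_ k) sk] := decay K g sg pig0.
  by have := sqrtV_boundedM sh sk; eexists; eassumption.
have ik k : pi.-integrable setT (EFin \o (fun z => h z * Pn k g z)).
  by have [c /(V_bounded_integrable 0 point)[]] := bhk k.
have [iS SE] := Rintegral_sum (index_iota 0 N) ik.
have [_ ip] := V_bounded_integrable 0 point (sqrtV_boundedM sh sp).
have -> : \int[pi]_z (h z * (poisson g z - series (fun k => Pn k g z) N)) =
    \int[pi]_z (h z * poisson g z) - series (fun k => \int[pi]_z (h z * Pn k g z)) N.
  rewrite {2}/series /= -SE -RintegralB//; apply: eq_Rintegral => z _.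
  by rewrite mulrBr /series /= mulr_sumr.
by move=> /le_trans; apply; rewrite le_eqVlt; apply/orP; left; apply/eqP; ring.
Qed.

End WeightedErgodicity.

(** * The Markov property for functions *)

Section SubSigmaAlgebra.
Local Open Scope ereal_scope.
Context {d} {T : measurableType d} {R : realType}.
Variables (mu : {measure set T -> \bar R}) (G : set (set T)).
Hypothesis subG : <<s G >> `<=` measurable.

(** Two densities with equal integrals over every event of a sub-sigma-algebra have
    the same integral against every function measurable for it. *)
Lemma ge0_integral_weight_eq (a b : T -> \bar R) :
  measurable_fun [set: T] a -> measurable_fun [set: T] b ->
  (forall w, 0 <= a w) -> (forall w, 0 <= b w) ->
  (forall w, a w \is a fin_num) -> (forall w, b w \is a fin_num) ->
  (forall E, <<s G >> E -> \int[mu]_(w in E) a w = \int[mu]_(w in E) b w) ->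
  forall Y : T -> \bar R, measurable_fun [set: g_sigma_algebraType G] Y ->
    (forall w, 0 <= Y w) ->
  \int[mu]_w (Y w * a w) = \int[mu]_w (Y w * b w).
Proof.
move=> ma mb a0 b0 fa fb ab.
have meas (f : T -> \bar R) : measurable_fun [set: g_sigma_algebraType G] f ->
    measurable_fun [set: T] f.
  by move=> mf _ B mB; apply: subG; exact: mf.
apply: (@ge0_measurable_fun_ind _ (g_sigma_algebraType G) R).
- move=> A mA; have := ab A mA.
  rewrite integral_mkcond [in RHS]integral_mkcond => E.
  have h (c : T -> \bar R) : \int[mu]_w ((\1_A w)%:E * c w) = \int[mu]_w (c \_ A) w.
    apply: eq_integral => w _; rewrite /patch indicE.
    by case: ifP => _; rewrite ?mul1e ?mul0e.
  by rewrite !h.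
- move=> f g mf mg f0 g0 Ef Eg; have mf' := meas _ mf; have mg' := meas _ mg.
  have h (c : T -> \bar R) : measurable_fun [set: T] c -> (forall w, 0 <= c w) ->
      \int[mu]_w ((f \+ g) w * c w) = \int[mu]_w (f w * c w) + \int[mu]_w (g w * c w).
    move=> mc c0; rewrite -ge0_integralD//.
    + by apply: eq_integral => w _; rewrite ge0_muleDl.
    + by move=> w _; rewrite mule_ge0.
    + exact: emeasurable_funM.
    + by move=> w _; rewrite mule_ge0.
    + exact: emeasurable_funM.
  by rewrite !h// Ef Eg.
- move=> c f c0 mf f0 Ef; have mf' := meas _ mf.
  have h (k : T -> \bar R) : measurable_fun [set: T] k -> (forall w, 0 <= k w) ->
      \int[mu]_w (c%:E * f w * k w) = c%:E * \int[mu]_w (f w * k w).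
    move=> mk k0; rewrite -ge0_integralZl_EFin//.
    + by apply: eq_integral => w _; rewrite muleA.
    + by move=> w _; rewrite mule_ge0.
    + exact: emeasurable_funM.
  by rewrite !h// Ef.
- move=> f_ mf f0 nd Ef; have mf' k := meas _ (mf k).
  have h (c : T -> \bar R) : measurable_fun [set: T] c -> (forall w, 0 <= c w) ->
      (forall w, c w \is a fin_num) ->
      \int[mu]_w (limn (f_ ^~ w) * c w) = limn (fun n => \int[mu]_w (f_ n w * c w)).
    move=> mc c0 fc; rewrite -monotone_convergence//.
    + apply: eq_integral => w _; rewrite limeMr//.
      exact: ereal_nondecreasing_is_cvgn.
    + by move=> n; exact: emeasurable_funM.
    + by move=> n w _; rewrite mule_ge0.
    + by move=> w _ m n mn; rewrite lee_wpmul2r// nd.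
  by rewrite !h//; congr (limn _); apply/funext => n; exact: Ef.
Qed.

End SubSigmaAlgebra.

Section Adapted.
Context {R : realType} {Z : ptopologicalType}.
Variable P : R.-pker (borel Z) ~> (borel Z).
Context {dO : measure_display} {Omega : measurableType dO}.
Variable Pr : probability Omega R.
Context {disp : Order.disp_t} {I : porderType disp}.
Variables (next : I -> I) (X : I -> Omega -> Z).
Hypothesis chain : markov_chain P Pr next X.

(** Generators of the sigma-algebra of the past of time [n]. *)
Definition past_events (n : I) : set (set Omega) :=
  [set E | exists j (B : set (borel Z)),
     [/\ (j <= n)%O, measurable B & E = X j @^-1` B]].

Definition adapted n (Y : Omega -> R) :=
  measurable_fun [set: g_sigma_algebraType (past_events n)] Y.

Lemma measurable_state n : measurable_fun [set: Omega] (X n : Omega -> borel Z).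
Proof. exact: chain.1. Qed.

Lemma past_measurable n (E : set Omega) : <<s past_events n >> E -> measurable E.
Proof.
apply: smallest_sub; first exact: sigma_algebra_measurable.
move=> _ [j [B [_ mB ->]]].
by rewrite -[X in measurable X]setTI; exact: measurable_state.
Qed.

Lemma past_measurable_fun n d (T : measurableType d) (Y : Omega -> T) :
  measurable_fun [set: g_sigma_algebraType (past_events n)] Y ->
  measurable_fun [set: Omega] Y.
Proof. by move=> aY _ B mB; apply: (@past_measurable n); exact: aY. Qed.

Lemma adapted_state j n (g : Z -> R) : (j <= n)%O ->
  measurable_fun [set: borel Z] g -> adapted n (g \o X j).
Proof.
move=> jn mg; apply: (measurableT_comp mg) => _ B mB.
by rewrite setTI; apply: sub_sigma_algebra; exists j, B.
Qed.

Lemma adapted_le m n Y : (m <= n)%O -> adapted m Y -> adapted n Y.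
Proof.
move=> mn aY _ B mB; have := aY measurableT B mB.
apply: sub_sigma_algebra2 => _ [j [C [jm mC ->]]]; exists j, C; split => //.
exact: le_trans mn.
Qed.

Section Nonnegative.
Local Open Scope ereal_scope.

Let integral_kernel_state n (g : Z -> \bar R) : measurable_fun [set: borel Z] g ->
  (forall z, 0 <= g z) ->
  measurable_fun [set: Omega] (fun w => \int[P (X n w)]_z g z).
Proof.
move=> mg g0.
apply: (measurableT_comp (f := fun y : borel Z => \int[P y]_z g z)) (measurable_state n).
by apply: measurable_fun_integral_kernel => // U mU; exact: measurable_kernel.
Qed.

(** Extends the defining identity of a Markov chain from events of the past and
    Borel sets to functions, first in [Y] and then in [g]. *)
Lemma ge0_markov_past n (Y : Omega -> R) (g : Z -> \bar R) :
  adapted n Y -> (forall w, 0 <= Y w)%R -> measurable_fun [set: borel Z] g ->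
  (forall z, 0 <= g z) ->
  \int[Pr]_w ((Y w)%:E * g (X (next n) w)) =
  \int[Pr]_w ((Y w)%:E * \int[P (X n w)]_z g z).
Proof.
move=> aY Y0; have mY : measurable_fun [set: Omega] (EFin \o Y).
  by apply/measurable_EFinP; exact: past_measurable_fun aY.
have mXn (f : Z -> \bar R) : measurable_fun [set: borel Z] f ->
    measurable_fun [set: Omega] (f \o X (next n)).
  by move=> mf; exact: (measurableT_comp mf (measurable_state (next n))).
have ig (f : Z -> \bar R) w : (forall z, 0 <= f z) -> 0 <= \int[P (X n w)]_z f z.
  by move=> f0; exact: integral_ge0.
have Yn (f : Z -> \bar R) w : (forall z, 0 <= f z) ->
    0 <= (Y w)%:E * f (X (next n) w).
  by move=> f0; rewrite mule_ge0// lee_fin.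
have Yi (f : Z -> \bar R) w : (forall z, 0 <= f z) ->
    0 <= (Y w)%:E * \int[P (X n w)]_z f z.
  by move=> f0; rewrite mule_ge0 ?lee_fin ?ig.
have mYX (f : Z -> \bar R) : measurable_fun [set: borel Z] f ->
    measurable_fun [set: Omega] (fun w => (Y w)%:E * f (X (next n) w)).
  by move=> mf; apply: emeasurable_funM => //; exact: mXn.
have mYi (f : Z -> \bar R) : measurable_fun [set: borel Z] f ->
    (forall z, 0 <= f z) ->
    measurable_fun [set: Omega] (fun w => (Y w)%:E * \int[P (X n w)]_z f z).
  by move=> mf f0; apply: emeasurable_funM => //; exact: integral_kernel_state.
move: g; apply: (@ge0_measurable_fun_ind _ (borel Z) R (fun g =>
  \int[Pr]_w ((Y w)%:E * g (X (next n) w)) =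
  \int[Pr]_w ((Y w)%:E * \int[P (X n w)]_z g z))).
- move=> B mB.
  transitivity (\int[Pr]_w ((Y w)%:E * P (X n w) B)); last first.
    by apply: eq_integral => w _; rewrite integral_indic// setIT.
  apply: (@ge0_integral_weight_eq _ _ _ Pr (past_events n)) => //.
  + exact: past_measurable.
  + by apply: (mXn (fun z => (\1_B z)%:E)); exact/measurable_EFinP.
  + exact: (measurableT_comp (measurable_kernel P B mB) (measurable_state n)).
  + move=> w; rewrite ge0_fin_numE//.
    apply: le_lt_trans (ltry 1); rewrite -(prob_kernel (s := P) (X n w)).
    by apply: le_measure; [exact: mem_set|exact: mem_set|move=> ?]. 
  + move=> E mE; rewrite -(chain.2 n B E mB mE).
    transitivity (\int[Pr]_(w in E) (\1_(X (next n) @^-1` B) w)%:E) => //.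
    have mE' := past_measurable mE.
    have mXB : measurable (X (next n) @^-1` B).
      by rewrite -[X in measurable X]setTI; exact: measurable_state.
    by rewrite integral_indic// setIC.
  + by apply/measurable_EFinP.
- move=> f g mf mg f0 g0 Ef Eg.
  under eq_integral do rewrite ge0_muleDr//.
  rewrite (ge0_integralD Pr measurableT (fun w _ => Yn f w f0) (mYX f mf)
    (fun w _ => Yn g w g0) (mYX g mg)).
  rewrite Ef Eg -(ge0_integralD Pr measurableT (fun w _ => Yi f w f0) (mYi f mf f0)
    (fun w _ => Yi g w g0) (mYi g mg g0)).
  apply: eq_integral => w _; rewrite -ge0_muleDr ?ig//.
  by rewrite (ge0_integralD (P (X n w)) measurableT (fun z _ => f0 z) mf
    (fun z _ => g0 z) mg).
- move=> c f c0 mf f0 Ef.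
  under eq_integral do rewrite muleCA.
  rewrite (ge0_integralZl_EFin Pr measurableT (fun w _ => Yn f w f0) (mYX f mf) c0).
  rewrite Ef -(ge0_integralZl_EFin Pr measurableT (fun w _ => Yi f w f0)
    (mYi f mf f0) c0).
  apply: eq_integral => w _.
  by rewrite (ge0_integralZl_EFin (P (X n w)) measurableT (fun z _ => f0 z) mf c0) muleCA.
- move=> f_ mf f0 nd Ef.
  transitivity (limn (fun k => \int[Pr]_w ((Y w)%:E * f_ k (X (next n) w)))).
    rewrite -monotone_convergence//.
    + apply: eq_integral => w _; rewrite limeMl//.
      exact: ereal_nondecreasing_is_cvgn.
    + by move=> k; apply: emeasurable_funM => //; exact: mXn.
    + by move=> k w _; rewrite mule_ge0// lee_fin.
    + by move=> w _ k l kl; rewrite lee_wpmul2l ?lee_fin// nd.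
  under eq_fun do rewrite Ef.
  rewrite -monotone_convergence//.
  + apply: eq_integral => w _; rewrite limeMl//; last first.
      apply: ereal_nondecreasing_is_cvgn => k l kl.
      by apply: ge0_le_integral => // z _; exact: nd.
    by rewrite monotone_convergence.
  + by move=> k; apply: emeasurable_funM => //; exact: integral_kernel_state.
  + by move=> k w _; rewrite mule_ge0 ?lee_fin ?ig.
  + move=> w _ k l kl; rewrite lee_wpmul2l ?lee_fin//.
    by apply: ge0_le_integral => // z _; exact: nd.
Qed.

End Nonnegative.
End Adapted.

(** * Chains with V-integrable states *)

Section Law.
Context {R : realType} {d d'} {T : measurableType d} {U : measurableType d'}.
Variables (mu : {measure set T -> \bar R}) (nu : {measure set U -> \bar R}).
Variable X : T -> U.
Hypothesis mX : measurable_fun [set: T] X.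
Hypothesis lawX : forall B, measurable B -> mu (X @^-1` B) = nu B.

Lemma ge0_integral_law (g : U -> \bar R) : measurable_fun [set: U] g ->
  (forall x, 0 <= g x)%E -> (\int[mu]_w g (X w) = \int[nu]_x g x)%E.
Proof.
move=> mg g0; rewrite [RHS](eq_measure_integral (pushforward mu X)).
  by rewrite [RHS]ge0_integral_pushforward.
by move=> B mB _; exact/esym/lawX.
Qed.

Lemma integrable_law (g : U -> R) : nu.-integrable setT (EFin \o g) ->
  mu.-integrable setT (EFin \o (fun w => g (X w))).
Proof.
move=> /integrableP[mg ig]; have mg' := measurableT_comp mg mX.
apply/integrableP; split => //.
have mag : measurable_fun [set: U] (fun x => `|(EFin \o g) x|%E).
  by apply: measurableT_comp => //; exact: mg.
by rewrite (ge0_integral_law mag).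
Qed.

Lemma Rintegral_law (g : U -> R) : nu.-integrable setT (EFin \o g) ->
  \int[mu]_w g (X w) = \int[nu]_x g x.
Proof.
move=> ig; have ig' := integrable_law ig; have /integrableP[mg _] := ig.
rewrite /Rintegral; congr fine.
rewrite [RHS](eq_measure_integral (pushforward mu X)).
  by rewrite [RHS]integral_pushforward.
by move=> B mB _; exact/esym/lawX.
Qed.

End Law.

Section SignedMarkov.
Context {R : realType} {Z : ptopologicalType}.
Variable P : R.-pker (borel Z) ~> (borel Z).
Context {dO : measure_display} {Omega : measurableType dO}.
Variable Pr : probability Omega R.
Context {disp : Order.disp_t} {I : porderType disp}.
Variables (next : I -> I) (X : I -> Omega -> Z).
Hypothesis chain : markov_chain P Pr next X.

Lemma ge0_Rintegral_markov_past n (Y : Omega -> R) (g : Z -> R) :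
  adapted X n Y -> (forall w, 0 <= Y w) -> (forall z, 0 <= g z) ->
  measurable_fun [set: borel Z] g ->
  (forall z, (P z).-integrable setT (EFin \o g)) ->
  Pr.-integrable setT (EFin \o (fun w => Y w * g (X (next n) w))) ->
  Pr.-integrable setT (EFin \o (fun w => Y w * \int[P (X n w)]_z g z)) /\
  \int[Pr]_w (Y w * g (X (next n) w)) =
  \int[Pr]_w (Y w * \int[P (X n w)]_z g z).
Proof.
move=> aY Y0 g0 mg ig iYg.
have mYg : measurable_fun [set: borel Z] (EFin \o g) by exact/measurable_EFinP.
have E := ge0_markov_past chain aY Y0 mYg (fun z => g0 z).
have E2 w : ((Y w * \int[P (X n w)]_z g z)%:E =
    (Y w)%:E * \int[P (X n w)]_z (g z)%:E)%E.
  by rewrite EFinM /Rintegral fineK//; exact: integrable_fin_num.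
have Eint : (\int[Pr]_w (Y w * g (X (next n) w))%:E =
    \int[Pr]_w (Y w * \int[P (X n w)]_z g z)%:E)%E.
  by under [RHS]eq_integral do rewrite E2; rewrite -E.
split; last by rewrite /Rintegral Eint.
have mP : measurable_fun [set: Omega] (fun w => \int[P (X n w)]_z g z).
  apply: (measurableT_comp (f := fun y : borel Z => \int[P y]_z g z)); last first.
    exact: (measurable_state chain).
  apply: (measurableT_comp (@fine_measurable R _ measurableT)).
  apply: measurable_fun_integral_kernel; last exact: mYg.
  - by move=> U mU; exact: measurable_kernel.
  - by move=> z; rewrite lee_fin.
apply/integrableP; split.
  apply/measurable_EFinP; apply: measurable_funM => //.
  exact: (@past_measurable_fun _ _ _ _ _ _ _ _ _ _ chain n _ _ _ aY).
have /integrableP[_] := iYg.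
rewrite (eq_integral (fun w => (Y w * g (X (next n) w))%:E)); last first.
  by move=> w _; rewrite /= ger0_norm// mulr_ge0.
rewrite Eint; congr (_ < _)%E; apply: eq_integral => w _ /=.
by rewrite ger0_norm// mulr_ge0//; exact: Rintegral_ge0.
Qed.

(** Signed functions are split into positive and negative parts; square
    integrability makes the four resulting integrals finite. *)
Lemma Rintegral_markov_past n (Y : Omega -> R) (g : Z -> R) :
  adapted X n Y -> square_integrable Pr Y ->
  measurable_fun [set: borel Z] g ->
  (forall z, (P z).-integrable setT (EFin \o g)) ->
  square_integrable Pr (g \o X (next n)) ->
  \int[Pr]_w (Y w * g (X (next n) w)) =
  \int[Pr]_w (Y w * \int[P (X n w)]_z g z).
Proof.
move=> aY sY mg ig sg.
pose pos (x : R) := Num.max x 0; pose neg (x : R) := Num.max (- x) 0.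
have posneg d (T : measurableType d) (mu : {measure set T -> \bar R}) (h : T -> R) :
    mu.-integrable setT (EFin \o h) -> mu.-integrable setT (EFin \o (pos \o h)) /\
      mu.-integrable setT (EFin \o (neg \o h)).
  move=> ih; have /integrableP[/measurable_EFinP mh _] := ih.
  split; apply: (le_integrable measurableT _ _ ih).
  - by apply/measurable_EFinP; exact: measurable_maxr.
  - move=> x _ /=; rewrite lee_fin /pos /Num.max; case: ifP => //.
    by rewrite normr0.
  - by apply/measurable_EFinP; apply: measurable_maxr => //; exact: measurableT_comp.
  - move=> x _ /=; rewrite lee_fin /neg /Num.max; case: ifP => //.
      by rewrite normr0.
    by rewrite normrN.
have mpos d (T : measurableType d) (h : T -> R) : measurable_fun [set: T] h ->
    measurable_fun [set: T] (pos \o h) /\ measurable_fun [set: T] (neg \o h).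
  move=> mh; split; apply: measurable_maxr => //; exact: measurableT_comp.
have sqpos d (T : measurableType d) (mu : {measure set T -> \bar R}) (h : T -> R) :
    square_integrable mu h -> square_integrable mu (pos \o h) /\
      square_integrable mu (neg \o h).
  move=> [mh ih]; have [mp mn] := mpos _ _ _ mh.
  split; split => //; apply: (le_integrable measurableT _ _ ih).
  - by apply/measurable_EFinP; exact: measurable_funX.
  - move=> x _ /=; rewrite lee_fin !ger0_norm ?sqr_ge0// /pos /Num.max.
    by case: ifP => //; rewrite expr0n sqr_ge0.
  - by apply/measurable_EFinP; exact: measurable_funX.
  - move=> x _ /=; rewrite lee_fin !ger0_norm ?sqr_ge0// /neg /Num.max.
    by case: ifP => //; rewrite ?sqrrN// expr0n sqr_ge0.
have p0 x : 0 <= pos x by rewrite le_max lexx orbT.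
have n0 x : 0 <= neg x by rewrite le_max lexx orbT.
have [sYp sYn] := sqpos _ _ _ _ sY.
have [sgp sgn] := sqpos _ _ _ _ sg.
have [mgp mgn] := mpos _ _ _ mg.
have [aYp aYn] := mpos _ _ _ aY.
have igp z := (posneg _ _ _ _ (ig z)).1.
have ign z := (posneg _ _ _ _ (ig z)).2.
have ipp := square_integrable_mul sYp sgp.
have ipn := square_integrable_mul sYp sgn.
have inp := square_integrable_mul sYn sgp.
have inn := square_integrable_mul sYn sgn.
have [jpp Epp] := ge0_Rintegral_markov_past aYp (fun w => p0 _) (fun z => p0 _) mgp igp ipp.
have [jpn Epn] := ge0_Rintegral_markov_past aYp (fun w => p0 _) (fun z => n0 _) mgn ign ipn.
have [jnp Enp] := ge0_Rintegral_markov_past aYn (fun w => n0 _) (fun z => p0 _) mgp igp inp.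
have [jnn Enn] := ge0_Rintegral_markov_past aYn (fun w => n0 _) (fun z => n0 _) mgn ign inn.
have pn x : x = pos x - neg x := maxr_posneg x.
have split4 (a b : Omega -> R) (c e : Omega -> R) :
    Pr.-integrable setT (EFin \o (fun w => a w * c w)) ->
    Pr.-integrable setT (EFin \o (fun w => a w * e w)) ->
    Pr.-integrable setT (EFin \o (fun w => b w * c w)) ->
    Pr.-integrable setT (EFin \o (fun w => b w * e w)) ->
    \int[Pr]_w ((a w - b w) * (c w - e w)) =
    (\int[Pr]_w (a w * c w) - \int[Pr]_w (a w * e w)) -
    (\int[Pr]_w (b w * c w) - \int[Pr]_w (b w * e w)).
  move=> i1 i2 i3 i4; rewrite -!RintegralB//.
  - by apply: eq_Rintegral => w _; ring.
  - exact: (integrableB _ i1 i2).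
  - exact: (integrableB _ i3 i4).
transitivity (\int[Pr]_w (((pos \o Y) w - (neg \o Y) w) *
  ((pos \o (g \o X (next n))) w - (neg \o (g \o X (next n))) w))).
  by apply: eq_Rintegral => w _; rewrite /= -!pn.
rewrite (split4 _ _ _ _ ipp ipn inp inn) Epp Epn Enp Enn.
rewrite -(split4 _ _ _ _ jpp jpn jnp jnn).
apply: eq_Rintegral => w _; rewrite -RintegralB// -pn; congr (_ * _).
by apply: eq_Rintegral => z _; rewrite /= -pn.
Qed.

End SignedMarkov.

Section ErgodicChain.
Context {R : realType} {Z : ptopologicalType}.
Variables (P : R.-pker (borel Z) ~> (borel Z)) (V : Z -> R).
Variable pi : probability (borel Z) R.
Hypothesis mV : measurable_fun [set: borel Z] V.
Hypothesis V1 : forall z, 1 <= V z.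
Hypothesis ergodic : V_uniformly_ergodic P V pi.

Let V0 z : 0 < V z. Proof. exact: lt_le_trans (V1 z). Qed.

Section Generic.
Context {dO : measure_display} {Omega : measurableType dO}.
Variable Pr : probability Omega R.
Context {disp : Order.disp_t} {I : porderType disp}.
Variables (next : I -> I) (X : I -> Omega -> Z).
Hypothesis chain : markov_chain P Pr next X.
Hypothesis next_ge : forall n, (n <= next n)%O.
Hypothesis iV : forall n, Pr.-integrable setT (EFin \o (V \o X n)).

Lemma integrable_state c g n : V_bounded V c g ->
  Pr.-integrable setT (EFin \o (g \o X n)).
Proof.
move=> [c0 mg gc].
apply: (le_integrable measurableT _ _ (integrableZl measurableT c (iV n))).
  by apply/measurable_EFinP; exact: (measurableT_comp mg (measurable_state chain n)).
move=> w _ /=; rewrite lee_fin (le_trans (gc _))// ger0_norm// mulr_ge0//.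
exact: ltW.
Qed.

Lemma square_integrable_state K g n : sqrtV_bounded V K g ->
  square_integrable Pr (g \o X n).
Proof.
move=> sg; split.
  by have [_ mg _] := sg; exact: (measurableT_comp mg (measurable_state chain n)).
have := integrable_state n (sqrtV_boundedM V1 sg sg).
by apply: eq_integrable => // w _ /=; rewrite expr2.
Qed.

(** The mean of [g] is required to vanish so that every P^k g stays bounded by a
    multiple of sqrt V, hence square integrable along the chain. *)
Lemma Rintegral_markov_iter K g k n (Y : Omega -> R) :
  sqrtV_bounded V K g -> \int[pi]_z g z = 0 ->
  adapted X n Y -> square_integrable Pr Y ->
  \int[Pr]_w (Y w * g (X (iter k next n) w)) = \int[Pr]_w (Y w * Pn P k g (X n w)).
Proof.
move=> sg pig0; have bg := sqrtV_bounded_V V1 sg.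
elim: k n => [|k IH] n aY sY.
  by apply: eq_Rintegral => w _; rewrite (Pn0 _ _ bg).
rewrite iterSr (IH _ (adapted_le (next_ge n) aY) sY).
have [q _ decay] := sqrtV_decay V1 ergodic.
have [C _ dec] := decay K g sg pig0; have sPk := dec k.
have := Rintegral_markov_past chain aY sY _ _ (square_integrable_state (next n) sPk).
move=> ->.
- by apply: eq_Rintegral => w _; rewrite (PnS V1 ergodic k _ bg).
- by have [] := sPk.
- by move=> z; exact: (V_bounded_integrable_P V1 ergodic z (sqrtV_bounded_V V1 sPk)).
Qed.

(** The increments F(X_(n+1)) - PF(X_n) are orthogonal to the past. *)
Lemma Rintegral_poisson_past K g n (Y : Omega -> R) :
  sqrtV_bounded V K g -> \int[pi]_z g z = 0 ->
  adapted X n Y -> square_integrable Pr Y ->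
  \int[Pr]_w (Y w * (poisson P g (X (next n) w) - (poisson P g (X n w) - g (X n w)))) = 0.
Proof.
move=> sg pig0 aY sY.
have [C sp] := sqrtV_bounded_poisson V1 ergodic sg pig0.
have sH := sqrtV_boundedB sp sg.
have sYF := square_integrable_mul sY (square_integrable_state (next n) sp).
have sYH := square_integrable_mul sY (square_integrable_state n sH).
under eq_Rintegral do rewrite mulrBr.
rewrite RintegralB//.
rewrite (Rintegral_markov_past chain aY sY _ _ (square_integrable_state (next n) sp)).
- apply/eqP; rewrite subr_eq0; apply/eqP; apply: eq_Rintegral => w _.
  by rewrite (poisson_equation mV V1 ergodic sg pig0).
- by have [] := sp.
- by move=> z; exact: (V_bounded_integrable_P V1 ergodic z (sqrtV_bounded_V V1 sp)).
Qed.

End Generic.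

(** Substitute f = F - H with H = F - f: then f_j F_i + f_i H_j = F_i F_j - H_i H_j. *)
Lemma Rintegral_cov_telescope Ki Kj Ci Cj (fi fj Fi Fj : Z -> R) :
  sqrtV_bounded V Ki fi -> sqrtV_bounded V Kj fj ->
  sqrtV_bounded V Ci Fi -> sqrtV_bounded V Cj Fj ->
  \int[pi]_z (fj z * Fi z) + \int[pi]_z (fi z * (Fj z - fj z)) =
  \int[pi]_z (Fi z * Fj z) - \int[pi]_z ((Fi z - fi z) * (Fj z - fj z)).
Proof.
move=> sfi sfj sFi sFj.
have ig A B g h : sqrtV_bounded V A g -> sqrtV_bounded V B h ->
    pi.-integrable setT (EFin \o (fun z => g z * h z)).
  move=> sg sh; have bgh := sqrtV_boundedM V1 sg sh.
  by have [] := V_bounded_integrable V1 ergodic 0 point bgh.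
have sHi := sqrtV_boundedB sFi sfi; have sHj := sqrtV_boundedB sFj sfj.
rewrite -(RintegralD measurableT (ig _ _ _ _ sfj sFi) (ig _ _ _ _ sfi sHj)).
rewrite -(RintegralB measurableT (ig _ _ _ _ sFi sFj) (ig _ _ _ _ sHi sHj)).
by apply: eq_Rintegral => z _; ring.
Qed.

Section Stationary.
Context {dS : measure_display} {OmegaS : measurableType dS}.
Variables (PrS : probability OmegaS R) (X : int -> OmegaS -> Z).
Hypothesis stat : stationary_version P PrS pi X.
Context {d : nat}.
Variable f : Z -> 'cV[R]_d.
Variable K : 'I_d -> R.
Hypothesis sf : forall i, sqrtV_bounded V (K i) (fun z => f z i 0).
Hypothesis pif0 : forall i, \int[pi]_z f z i 0 = 0.

Let chain : markov_chain P PrS (fun k => k + 1) X. Proof. exact: stat.1. Qed.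

Let iV n : PrS.-integrable setT (EFin \o (V \o X n)).
Proof.
have [_ ipV] := V_bounded_integrable V1 ergodic 0 point (V_bounded_V mV V1).
exact: (integrable_law (measurable_state chain n) (stat.2 n) ipV).
Qed.

Let law c g n : V_bounded V c g -> \int[PrS]_w g (X n w) = \int[pi]_z g z.
Proof.
move=> bg; have [_ ig] := V_bounded_integrable V1 ergodic 0 point bg.
exact: (Rintegral_law (measurable_state chain n) (stat.2 n) ig).
Qed.

Let iter_shift k (n : int) : iter k (fun k : int => k + 1) n = n + k%:Z.
Proof.
elim: k => [|k IH] /=; first by rewrite addr0.
by rewrite IH -addrA -PoszD addn1.
Qed.

Let shift_ge (n : int) : (n <= n + 1)%O.
Proof. by rewrite lerDl. Qed.

(** The two states have lag [k], so conditioning on the earlier one leaves P^k. *)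
Lemma stationary_cov n k i j :
  \int[PrS]_w (f (X n w) j 0 * f (X (n + k%:Z) w) i 0) =
  \int[pi]_z (f z j 0 * Pn P k (fun z => f z i 0) z).
Proof.
have [_ mj _] := sf j.
rewrite -iter_shift.
rewrite (Rintegral_markov_iter chain shift_ge iV k (sf i) (pif0 i)
  (adapted_state (lexx n) mj) (square_integrable_state chain iV n (sf j))).
have [q _ decay] := sqrtV_decay V1 ergodic.
have [C _ dec] := decay _ _ (sf i) (pif0 i).
exact: law n (sqrtV_boundedM V1 (sf j) (dec k)).
Qed.

Let F i := poisson P (fun z => f z i 0).
Let H i z := F i z - f z i 0.

(** The lag-k covariance is the integral of f_j P^k f_i for k >= 0 and of f_i P^k f_j
    for lag -k. Summation over k turns P^k f into the Poisson solution F, or into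
    H = F - f when the term k = 0 is missing. The result is the stationary second
    moment of the martingale increments, hence is positive semidefinite. *)
Lemma asymptotic_covE i j : asymptotic_cov PrS X f i j =
  \int[pi]_z (F i z * F j z) - \int[pi]_z (H i z * H j z).
Proof.
have autocovE k : autocov PrS X f k i j = \int[PrS]_w (f (X 0 w) j 0 * f (X k w) i 0).
  rewrite /autocov mxE unlock; congr fine; apply: eq_integral => w _.
  by rewrite mxE big_ord1 mxE mulrC.
have pos k : autocov PrS X f k%:Z i j = \int[pi]_z (f z j 0 * Pn P k (fun z => f z i 0) z).
  by rewrite autocovE -(stationary_cov 0) add0r.
have neg k : autocov PrS X f (- k.+1%:Z) i j =
    \int[pi]_z (f z i 0 * Pn P k.+1 (fun z => f z j 0) z).
  rewrite autocovE -(stationary_cov (- k.+1%:Z)) addNr.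
  by apply: eq_Rintegral => w _; rewrite mulrC.
have S1 := poisson_pi mV V1 ergodic (sf i) (pif0 i) (sf j).
have S2 := poisson_pi mV V1 ergodic (sf j) (pif0 j) (sf i).
have [Ci sFi] := sqrtV_bounded_poisson V1 ergodic (sf i) (pif0 i).
have [Cj sFj] := sqrtV_bounded_poisson V1 ergodic (sf j) (pif0 j).
have ig A B g h : sqrtV_bounded V A g -> sqrtV_bounded V B h ->
    pi.-integrable setT (EFin \o (fun z => g z * h z)).
  move=> sg sh; have bgh := sqrtV_boundedM V1 sg sh.
  by have [] := V_bounded_integrable V1 ergodic 0 point bgh.
rewrite /asymptotic_cov mxE.
rewrite (_ : limn _ = \int[pi]_z (f z j 0 * F i z)); last first.
  by under [X in series X]eq_fun do rewrite pos; exact: cvg_lim S1.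
rewrite (_ : limn _ = \int[pi]_z (f z i 0 * H j z)); last first.
  under [X in series X]eq_fun do rewrite neg.
  apply: cvg_lim => //.
  set u := (fun k => \int[pi]_z (f z i 0 * Pn P k (fun z => f z j 0) z)) in S2.
  have u0 : u 0%N = \int[pi]_z (f z i 0 * f z j 0).
    by apply: eq_Rintegral => z _; rewrite (Pn0 _ _ (sqrtV_bounded_V V1 (sf j))).
  have -> : series (fun k => u k.+1) = fun N => series u N.+1 - u 0%N.
    by apply/funext => N; rewrite /series /= big_nat_recl// addrC addKr.
  have -> : \int[pi]_z (f z i 0 * H j z) =
      \int[pi]_z (f z i 0 * F j z) - u 0%N.
    rewrite u0 -RintegralB//; [|exact: ig (sf i) sFj|exact: ig (sf i) (sf j)].
    by apply: eq_Rintegral => z _; rewrite -mulrBr.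
  by apply: cvgB; [rewrite cvg_shiftS|exact: cvg_cst].
exact: Rintegral_cov_telescope (sf i) (sf j) sFi sFj.
Qed.

End Stationary.

End ErgodicChain.

(** * The error recursion driven by the chain *)

Section MarkovFromPoint.
Context {R : realType} {Z : ptopologicalType}.
Variables (P : R.-pker (borel Z) ~> (borel Z)) (V : Z -> R).
Variable pi : probability (borel Z) R.
Hypothesis mV : measurable_fun [set: borel Z] V.
Hypothesis V1 : forall z, 1 <= V z.
Hypothesis ergodic : V_uniformly_ergodic P V pi.
Context {dO : measure_display} {Omega : measurableType dO}.
Variables (Pr : probability Omega R) (Phi : nat -> Omega -> Z) (z0 : Z).
Hypothesis chain : markov_chain P Pr succn Phi.
Hypothesis start : forall w, Phi 0%N w = z0.

(** The kernel powers are defined by one step first, so the induction moves the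
    Markov property along the starting time [k]. *)
Lemma ge0_integral_kernel_iter_state (g : Z -> \bar R) n k :
  measurable_fun [set: borel Z] g -> (forall z, 0 <= g z)%E ->
  (\int[Pr]_w g (Phi (k + n)%N w) = \int[Pr]_w \int[kernel_iter P n (Phi k w)]_z g z)%E.
Proof.
move=> mg g0; elim: n k => [|n IH] k.
  rewrite addn0; apply: eq_integral => w _.
  by rewrite ge0_integral_kernel_iter0.
rewrite addnS -addSn IH.
have mk := measurable_integral_kernel_iter P n mg g0.
have k0 z : (0 <= \int[kernel_iter P n z]_y g y)%E by apply: integral_ge0 => y _.
have a1 : adapted Phi k (cst (1 : R)) by exact: measurable_cst.
have := ge0_markov_past chain a1 (fun=> ler01) mk k0.
under eq_integral do rewrite mul1e.
move=> ->; apply: eq_integral => w _.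
by rewrite mul1e ge0_integral_kernel_iterS.
Qed.

Lemma state_law n (B : set (borel Z)) : measurable B ->
  Pr (Phi n @^-1` B) = kernel_iter P n z0 B.
Proof.
move=> mB.
have mXB : measurable (Phi n @^-1` B).
  by rewrite -[X in measurable X]setTI; exact: (measurable_state chain).
have := @ge0_integral_kernel_iter_state (fun z => (\1_B z)%:E) n 0.
rewrite add0n => E.
have := integral_indic Pr measurableT mXB; rewrite setIT => <-.
rewrite [LHS]E; [|exact/measurable_EFinP|by move=> z; rewrite lee_fin].
under eq_integral do rewrite start integral_indic// setIT.
rewrite integral_cst// [X in (_ * X)%E](_ : _ = 1%E) ?mule1//.
exact: probability_setT.
Qed.

Lemma integrable_V_state n : Pr.-integrable setT (EFin \o (V \o Phi n)).
Proof.
have [ikV _] := V_bounded_integrable V1 ergodic n z0 (V_bounded_V mV V1).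
exact: (integrable_law (measurable_state chain n) (@state_law n) ikV).
Qed.

Lemma Rintegral_state c g n : V_bounded V c g ->
  \int[Pr]_w g (Phi n w) = Pn P n g z0.
Proof.
move=> bg; have [ik _] := V_bounded_integrable V1 ergodic n z0 bg.
exact: (Rintegral_law (measurable_state chain n) (@state_law n) ik).
Qed.

Lemma Rintegral_state_cvg c g : V_bounded V c g ->
  (fun n => \int[Pr]_w g (Phi n w)) @ \oo --> \int[pi]_z g z.
Proof.
move=> bg; have [rho rho01 [B B0 rate]] := V_uniform_rate V1 ergodic.
apply: (@cvg_geometric_rate _ (B * c * V z0) rho) => // n.
rewrite (Rintegral_state _ bg) distrC mulrAC.
exact: rate.
Qed.

End MarkovFromPoint.

Section Noise.
Context {R : realType} {Z : ptopologicalType}.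
Variables (P : R.-pker (borel Z) ~> (borel Z)) (V : Z -> R).
Variable pi : probability (borel Z) R.
Hypothesis mV : measurable_fun [set: borel Z] V.
Hypothesis V1 : forall z, 1 <= V z.
Hypothesis ergodic : V_uniformly_ergodic P V pi.
Context {dO : measure_display} {Omega : measurableType dO}.
Variables (Pr : probability Omega R) (Phi : nat -> Omega -> Z) (z0 : Z).
Hypothesis chain : markov_chain P Pr succn Phi.
Hypothesis start : forall w, Phi 0%N w = z0.
Context {d : nat}.
Variables (A : 'M[R]_d) (f : Z -> 'cV[R]_d) (theta0 : 'cV[R]_d).
Variable K : 'I_d -> R.
Hypothesis sf : forall i, sqrtV_bounded V (K i) (fun z => f z i 0).
Hypothesis pif0 : forall i, \int[pi]_z f z i 0 = 0.

Let iV := integrable_V_state mV V1 ergodic chain start.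

Definition poissonV z : 'cV[R]_d := \col_i poisson P (fun z => f z i 0) z.
Definition poissonH z : 'cV[R]_d := poissonV z - f z.

(** A martingale increment: the part of the driving sequence that the past does not
    predict. *)
Definition noise n w : 'cV[R]_d := poissonV (Phi n.+1 w) - poissonH (Phi n w).

Definition theta n w := sa_iter A (fun k => f (Phi k w)) theta0 n.

(** Adding H(Phi_n)/n turns the correlated input into the martingale increments: the
    correction absorbs the telescoping part of
    f(Phi_(n+1)) = noise + H(Phi_n) - H(Phi_(n+1)). *)
Definition corrected n w := theta n w + step_size n *: poissonH (Phi n w).

(** The part of the next corrected iterate that the past determines. *)
Definition predicted n w := theta n w +
  step_size n.+1 *: (A *m theta n w + poissonH (Phi n w)).

Lemma corrected_rec n w :
  corrected n.+1 w = predicted n w + step_size n.+1 *: noise n w.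
Proof.
rewrite /corrected /predicted /noise /theta /=.
rewrite {1}/poissonH; move: (poissonH _) (poissonV _) (f _) (sa_iter _ _ _ _) (A *m _).
by move=> h F x t At; apply/matrixP => i j; rewrite !mxE; ring.
Qed.

(** For n = 0 the step size is the inverse of 0, whence the hypothesis. *)
Lemma predictedE n w : (0 < n)%N ->
  predicted n w = corrected n w + step_size n.+1 *: (A *m corrected n w -
    step_size n *: (poissonH (Phi n w) + A *m poissonH (Phi n w))).
Proof.
move=> n0; rewrite /predicted /corrected mulmxDr -scalemxAr.
set a := step_size n; set a' := step_size n.+1.
set t := theta n w; set h := poissonH _.
have aa : a' = a - a' * a.
  rewrite /a /a' /step_size -natr1; field.
  by rewrite natr1 !pnatr_eq0 -lt0n n0.
move: (A *m t) (A *m h) => At Ah; clearbody t h a a'; apply/matrixP => i j; rewrite !mxE.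
apply/eqP; rewrite -subr_eq0.
rewrite [X in X == 0](_ : _ = (a' - (a - a' * a)) * h i j); last by ring.
by rewrite -aa subrr mul0r.
Qed.

Lemma sqrtV_bounded_poissonV i : exists C, sqrtV_bounded V C (fun z => poissonV z i 0).
Proof.
have [C sp] := sqrtV_bounded_poisson V1 ergodic (sf i) (pif0 i); exists C.
by congr (sqrtV_bounded _ _ _): sp; apply/funext => z; rewrite mxE.
Qed.

Lemma sqrtV_bounded_poissonH i : exists C, sqrtV_bounded V C (fun z => poissonH z i 0).
Proof.
have [C sp] := sqrtV_bounded_poissonV i; exists (C + K i).
have := sqrtV_boundedB sp (sf i).
by congr (sqrtV_bounded _ _ _); apply/funext => z; rewrite !mxE.
Qed.

Definition square_integrableV (Y : Omega -> 'cV[R]_d) :=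
  forall i, square_integrable Pr (fun w => Y w i 0).

Lemma square_integrableVD Y Y' : square_integrableV Y -> square_integrableV Y' ->
  square_integrableV (fun w => Y w + Y' w).
Proof.
move=> sY sY' i; have := square_integrableD (sY i) (sY' i).
by congr (square_integrable _ _); apply/funext => w; rewrite mxE.
Qed.

Lemma square_integrableVZ a Y : square_integrableV Y ->
  square_integrableV (fun w => a *: Y w).
Proof.
move=> sY i; have := square_integrableZ a (sY i).
by congr (square_integrable _ _); apply/funext => w; rewrite mxE.
Qed.

Lemma square_integrableV_mulmx (M : 'M[R]_d) Y : square_integrableV Y ->
  square_integrableV (fun w => M *m Y w).
Proof.
move=> sY i.
have := square_integrable_sum (index_enum _) (fun j => square_integrableZ (M i j) (sY j)).
by congr (square_integrable _ _); apply/funext => w; rewrite mxE.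
Qed.

Lemma square_integrable_f n : square_integrableV (fun w => f (Phi n w)).
Proof. by move=> i; exact: (square_integrable_state V1 chain iV n (sf i)). Qed.

Lemma square_integrable_poissonV n : square_integrableV (fun w => poissonV (Phi n w)).
Proof.
move=> i; have [C sp] := sqrtV_bounded_poissonV i.
exact: (square_integrable_state V1 chain iV n sp).
Qed.

Lemma square_integrable_poissonH n : square_integrableV (fun w => poissonH (Phi n w)).
Proof.
move=> i; have [C sp] := sqrtV_bounded_poissonH i.
exact: (square_integrable_state V1 chain iV n sp).
Qed.

Lemma square_integrable_theta n : square_integrableV (theta n).
Proof.
elim: n => [|n IH] /=.
  move=> i; split; first exact: measurable_cst.
  exact: (finite_measure_integrable_cst Pr (theta0 i 0 ^+ 2) measurableT).
apply: square_integrableVD => //; apply: square_integrableVZ.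
by apply: square_integrableVD; [exact: square_integrableV_mulmx|exact: square_integrable_f].
Qed.

Lemma square_integrable_corrected n : square_integrableV (corrected n).
Proof.
apply: square_integrableVD; first exact: square_integrable_theta.
by apply: square_integrableVZ; exact: square_integrable_poissonH.
Qed.

Lemma square_integrable_predicted n : square_integrableV (predicted n).
Proof.
apply: square_integrableVD; first exact: square_integrable_theta.
apply: square_integrableVZ; apply: square_integrableVD.
  by apply: square_integrableV_mulmx; exact: square_integrable_theta.
exact: square_integrable_poissonH.
Qed.

Lemma square_integrable_noise n : square_integrableV (noise n).
Proof.
apply: square_integrableVD; first exact: square_integrable_poissonV.
have := square_integrableVZ (-1) (square_integrable_poissonH n).
by congr square_integrableV; apply/funext => w; rewrite scaleN1r.
Qed.

Definition adaptedV n (Y : Omega -> 'cV[R]_d) :=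
  forall i, adapted Phi n (fun w => Y w i 0).

Lemma adaptedVD n Y Y' : adaptedV n Y -> adaptedV n Y' ->
  adaptedV n (fun w => Y w + Y' w).
Proof.
move=> aY aY' i; rewrite (_ : (fun w => _) = (fun w => Y w i 0 + Y' w i 0)).
  exact: measurable_funD (aY i) (aY' i).
by apply/funext => w; rewrite mxE.
Qed.

Lemma adaptedVZ n a Y : adaptedV n Y -> adaptedV n (fun w => a *: Y w).
Proof.
move=> aY i; rewrite (_ : (fun w => _) = (fun w => a * Y w i 0)).
  by apply: measurable_funM (aY i); exact: measurable_cst.
by apply/funext => w; rewrite mxE.
Qed.

Lemma adaptedV_mulmx n (M : 'M[R]_d) Y : adaptedV n Y ->
  adaptedV n (fun w => M *m Y w).
Proof.
move=> aY i; rewrite (_ : (fun w => _) = (fun w => \sum_j M i j * Y w j 0)).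
  apply: measurable_sum => j; apply: measurable_funM (aY j).
  exact: measurable_cst.
by apply/funext => w; rewrite mxE.
Qed.

Lemma adapted_theta n : adaptedV n (theta n).
Proof.
elim: n => [|n IH] /=; first by move=> i; exact: measurable_cst.
have IH' : adaptedV n.+1 (theta n).
  by move=> i; apply: adapted_le (IH i); rewrite leEnat.
apply: adaptedVD => //; apply: adaptedVZ; apply: adaptedVD.
  exact: adaptedV_mulmx.
by move=> i; have [_ mf _] := sf i; apply: adapted_state mf.
Qed.

Lemma adapted_predicted n : adaptedV n (predicted n).
Proof.
apply: adaptedVD; first exact: adapted_theta.
apply: adaptedVZ; apply: adaptedVD.
  by apply: adaptedV_mulmx; exact: adapted_theta.
move=> i; have [C [_ mh _]] := sqrtV_bounded_poissonH i.
exact: (adapted_state (lexx n) mh).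
Qed.

Lemma noiseE n w i : noise n w i 0 = poissonV (Phi n.+1 w) i 0 -
  (poissonV (Phi n w) i 0 - f (Phi n w) i 0).
Proof. by rewrite !mxE. Qed.

Lemma noise_orthogonal n (Y : Omega -> R) j : adapted Phi n Y ->
  square_integrable Pr Y -> \int[Pr]_w (Y w * noise n w j 0) = 0.
Proof.
move=> aY sY.
have leS (k : nat) : (k <= k.+1)%O by rewrite leEnat.
have := Rintegral_poisson_past mV V1 ergodic chain iV (sf j) (pif0 j) aY sY.
move=> E; rewrite -[RHS]E; apply: eq_Rintegral => w _; congr (_ * _).
by rewrite noiseE !mxE.
Qed.

(** From F' = H + m, where m is orthogonal to the past and H is a function of it:
    F'_i F'_j = H_i H_j + m_i m_j + H_i m_j + H_j m_i and the mixed terms vanish. *)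
Lemma noise_moment n i j : \int[Pr]_w (noise n w i 0 * noise n w j 0) =
  \int[Pr]_w (poissonV (Phi n.+1 w) i 0 * poissonV (Phi n.+1 w) j 0) -
  \int[Pr]_w (poissonH (Phi n w) i 0 * poissonH (Phi n w) j 0).
Proof.
have sF := square_integrable_poissonV n.+1.
have sH := square_integrable_poissonH n.
have sm := square_integrable_noise n.
have aH k : adapted Phi n (fun w => poissonH (Phi n w) k 0).
  have [C [_ mh _]] := sqrtV_bounded_poissonH k.
  exact: (adapted_state (lexx n) mh).
have E1 := noise_orthogonal j (aH i) (sH i).
have E2 := noise_orthogonal i (aH j) (sH j).
have i1 := square_integrable_mul (sH i) (sm j).
have i2 := square_integrable_mul (sH j) (sm i).
have iFF := square_integrable_mul (sF i) (sF j).
have iHH := square_integrable_mul (sH i) (sH j).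
have i0 := square_integrable_mul (sm i) (sm j).
have i12 : Pr.-integrable setT (EFin \o (fun w =>
    poissonH (Phi n w) i 0 * noise n w j 0 + poissonH (Phi n w) j 0 * noise n w i 0)).
  exact: (integrableD measurableT i1 i2).
rewrite -(RintegralB measurableT iFF iHH).
transitivity (\int[Pr]_w (noise n w i 0 * noise n w j 0 +
  (poissonH (Phi n w) i 0 * noise n w j 0 + poissonH (Phi n w) j 0 * noise n w i 0))).
  by rewrite (RintegralD measurableT i0 i12) (RintegralD measurableT i1 i2) E1 E2 !addr0.
apply: eq_Rintegral => w _.
have nE k : noise n w k 0 = poissonV (Phi n.+1 w) k 0 - poissonH (Phi n w) k 0.
  by rewrite /noise; move: (poissonV _) (poissonH _) => x y; rewrite !mxE.
rewrite !nE; move: (poissonV _ _ _) (poissonV _ _ _) (poissonH _ _ _) (poissonH _ _ _).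
by move=> *; ring.
Qed.

Lemma noise_moment_cvg i j :
  (fun n => \int[Pr]_w (noise n w i 0 * noise n w j 0)) @ \oo -->
  \int[pi]_z (poissonV z i 0 * poissonV z j 0) -
  \int[pi]_z (poissonH z i 0 * poissonH z j 0).
Proof.
under eq_fun do rewrite noise_moment.
have [Ci sFi] := sqrtV_bounded_poissonV i; have [Cj sFj] := sqrtV_bounded_poissonV j.
have [Di sHi] := sqrtV_bounded_poissonH i; have [Dj sHj] := sqrtV_bounded_poissonH j.
have cF := Rintegral_state_cvg V1 ergodic chain start (sqrtV_boundedM V1 sFi sFj).
have cH := Rintegral_state_cvg V1 ergodic chain start (sqrtV_boundedM V1 sHi sHj).
move: cF; rewrite -cvg_shiftS /= => cF.
exact: (cvgB cF cH).
Qed.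

Lemma poissonH_moment_cvg i j :
  (fun n => \int[Pr]_w (poissonH (Phi n w) i 0 * poissonH (Phi n w) j 0)) @ \oo -->
  \int[pi]_z (poissonH z i 0 * poissonH z j 0).
Proof.
have [Di sHi] := sqrtV_bounded_poissonH i; have [Dj sHj] := sqrtV_bounded_poissonH j.
exact: (Rintegral_state_cvg V1 ergodic chain start (sqrtV_boundedM V1 sHi sHj)).
Qed.

End Noise.

(** * Second moments of complex linear forms *)

Section ComplexSquaredNorm.
Context {R : realType}.
Implicit Types x y l : R[i].

(** The squared modulus, valued in the reals. *)
Definition nsq (x : R[i]) : R := complex.Re x ^+ 2 + complex.Im x ^+ 2.

Lemma nsq_ge0 x : 0 <= nsq x. Proof. by rewrite addr_ge0 ?sqr_ge0. Qed.

Lemma nsqM x y : nsq (x * y) = nsq x * nsq y.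
Proof. by case: x => a b; case: y => c e; rewrite /nsq /=; ring. Qed.

Lemma nsqN x : nsq (- x) = nsq x.
Proof. by case: x => a b; rewrite /nsq /= !sqrrN. Qed.

Lemma nsqR (a : R) : nsq a%:C%C = a ^+ 2.
Proof. by rewrite /nsq /= expr0n addr0. Qed.

Lemma nsq_add_le2 x y : nsq (x + y) <= 2 * nsq x + 2 * nsq y.
Proof.
case: x => a b; case: y => c e; rewrite /nsq /=.
have := sqr_ge0 (a - c); have := sqr_ge0 (b - e); nra.
Qed.

Lemma nsq_add_ge x y (t : R) : 0 < t -> (1 - t) * nsq x - nsq y / t <= nsq (x + y).
Proof.
move=> t0; case: x => a b; case: y => c e; rewrite /nsq /= -subr_ge0.
rewrite [leRHS](_ : _ = (t * a + c) ^+ 2 / t + c ^+ 2 + ((t * b + e) ^+ 2 / t + e ^+ 2)).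
  have ti : 0 <= t^-1 by rewrite invr_ge0 ltW.
  by apply: addr_ge0; apply: addr_ge0; rewrite ?sqr_ge0// mulr_ge0 ?sqr_ge0.
by field; rewrite gt_eqF.
Qed.

(** Convexity of the square with weights 1 - e and e. *)
Lemma nsq_contraction x y l (e : R) : 0 < e < 1 -> nsq l <= (1 - e) ^+ 2 ->
  nsq (l * x + y) <= (1 - e) * nsq x + nsq y / e.
Proof.
move=> /andP[e0 e1] le.
have e1' : 0 < 1 - e by rewrite subr_gt0.
apply: (@le_trans _ _ (nsq (l * x) / (1 - e) + nsq y / e)).
  case: (l * x) => a b; case: y => c f; rewrite /nsq /= -subr_ge0.
  rewrite [leRHS](_ : _ = ((e * a - (1 - e) * c) ^+ 2 +
      (e * b - (1 - e) * f) ^+ 2) / ((1 - e) * e)).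
    by rewrite mulr_ge0 ?addr_ge0 ?sqr_ge0// invr_ge0 mulr_ge0// ltW.
  by field; rewrite !gt_eqF.
by rewrite lerD2r nsqM ler_pdivrMr// mulrAC ler_wpM2r ?nsq_ge0.
Qed.

End ComplexSquaredNorm.

Section ComplexSecondMoment.
Context {R : realType} {d : nat}.
Context {dO : measure_display} {Omega : measurableType dO}.
Variable Pr : probability Omega R.
Implicit Types (u : 'rV[R[i]]_d) (y : 'cV[R]_d) (Y : Omega -> 'cV[R]_d).

(** The value at a real vector of a complex linear form: the error is tested against
    the complex left eigenvectors and generalised eigenvectors of A. *)
Definition pairing u y : R[i] := (u *m complexify y) 0 0.

Lemma pairingD u y y' : pairing u (y + y') = pairing u y + pairing u y'.
Proof. by rewrite /pairing /complexify map_mxD mulmxDr mxE. Qed.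

Lemma pairingZ u (a : R) y : pairing u (a *: y) = a%:C%C * pairing u y.
Proof. by rewrite /pairing /complexify map_mxZ -scalemxAr mxE. Qed.

Lemma pairingM u (A : 'M[R]_d) y :
  pairing u (A *m y) = pairing (u *m complexify A) y.
Proof. by rewrite /pairing /complexify map_mxM mulmxA. Qed.

Lemma pairingDl u u' y : pairing (u + u') y = pairing u y + pairing u' y.
Proof. by rewrite /pairing mulmxDl mxE. Qed.

Lemma pairingZl (l : R[i]) u y : pairing (l *: u) y = l * pairing u y.
Proof. by rewrite /pairing -scalemxAl mxE. Qed.

Lemma nsq_pairing u y : nsq (pairing u y) =
  (\sum_i complex.Re (u 0 i) * y i 0) ^+ 2 + (\sum_i complex.Im (u 0 i) * y i 0) ^+ 2.
Proof.
rewrite /nsq /pairing mxE; congr (_ ^+ 2 + _ ^+ 2).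
- rewrite raddf_sum; apply: eq_bigr => i _; rewrite mxE.
  by case: (u 0 i) => a b /=; rewrite mulr0 subr0.
- rewrite raddf_sum; apply: eq_bigr => i _; rewrite mxE.
  by case: (u 0 i) => a b /=; rewrite mulr0 add0r.
Qed.

Definition msq u Y : R := \int[Pr]_w nsq (pairing u (Y w)).

(** For symmetric [S] this is the Hermitian form u S u^*: the imaginary terms cancel. *)
Definition quad u (S : 'I_d -> 'I_d -> R) : R :=
  \sum_i \sum_j (complex.Re (u 0 i) * complex.Re (u 0 j) +
                 complex.Im (u 0 i) * complex.Im (u 0 j)) * S i j.

Lemma nsq_pairing_quad u y :
  nsq (pairing u y) = quad u (fun i j => y i 0 * y j 0).
Proof.
rewrite nsq_pairing !expr2 !mulr_suml -big_split /=; apply: eq_bigr => i _.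
rewrite !mulr_sumr -big_split /=; apply: eq_bigr => j _; ring.
Qed.

Lemma msq_ge0 u Y : 0 <= msq u Y.
Proof. by apply: Rintegral_ge0 => w _; exact: nsq_ge0. Qed.

Lemma msq_quad u Y : square_integrableV Pr Y ->
  Pr.-integrable setT (EFin \o (fun w => nsq (pairing u (Y w)))) /\
  msq u Y = quad u (fun i j => \int[Pr]_w (Y w i 0 * Y w j 0)).
Proof.
move=> sY; have iY i j := square_integrable_mul (sY i) (sY j).
rewrite /msq; under [X in EFin \o X]eq_fun do rewrite nsq_pairing_quad.
under eq_Rintegral do rewrite nsq_pairing_quad.
rewrite /quad.
pose co i j := complex.Re (u 0 i) * complex.Re (u 0 j) +
                 complex.Im (u 0 i) * complex.Im (u 0 j).
have iterm i j : Pr.-integrable setT (EFin \o (fun w => co i j * (Y w i 0 * Y w j 0))).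
  exact: (integrableZl measurableT _ (iY i j)).
have h i := Rintegral_sum (index_enum 'I_d) (iterm i).
have [-> ->] := Rintegral_sum (index_enum 'I_d) (fun i => (h i).1).
split => //; apply: eq_bigr => i _; rewrite (h i).2; apply: eq_bigr => j _.
by rewrite RintegralZl.
Qed.

Lemma cvg_sum_real (I : Type) (r : seq I) (F : I -> nat -> R) (l : I -> R) :
  (forall i, F i @ \oo --> l i) ->
  (fun n => \sum_(i <- r) F i n) @ \oo --> \sum_(i <- r) l i.
Proof.
move=> h; elim: r => [|i r IH].
  by rewrite big_nil; under eq_fun do rewrite big_nil; exact: cvg_cst.
by rewrite big_cons; under eq_fun do rewrite big_cons; exact: cvgD (h i) IH.
Qed.

Lemma quad_cvg u (S_ : nat -> 'I_d -> 'I_d -> R) S :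
  (forall i j, (fun n => S_ n i j) @ \oo --> S i j) ->
  (fun n => quad u (S_ n)) @ \oo --> quad u S.
Proof.
move=> h; apply: cvg_sum_real => i; apply: cvg_sum_real => j.
exact: cvgM (cvg_cst _) (h i j).
Qed.

Lemma msq_le3 u u1 u2 u3 Y Y1 Y2 Y3 (a1 a2 a3 : R) :
  square_integrableV Pr Y -> square_integrableV Pr Y1 ->
  square_integrableV Pr Y2 -> square_integrableV Pr Y3 ->
  (forall w, nsq (pairing u (Y w)) <= a1 * nsq (pairing u1 (Y1 w)) +
     a2 * nsq (pairing u2 (Y2 w)) + a3 * nsq (pairing u3 (Y3 w))) ->
  msq u Y <= a1 * msq u1 Y1 + a2 * msq u2 Y2 + a3 * msq u3 Y3.
Proof.
move=> sY sY1 sY2 sY3 h.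
have [i0 _] := msq_quad u sY; have [i1 _] := msq_quad u1 sY1.
have [i2 _] := msq_quad u2 sY2; have [i3 _] := msq_quad u3 sY3.
have j1 := integrableZl measurableT a1 i1.
have j2 := integrableZl measurableT a2 i2.
have j3 := integrableZl measurableT a3 i3.
have j12 := integrableD measurableT j1 j2.
have j123 := integrableD measurableT j12 j3.
rewrite /msq -!RintegralZl//.
rewrite -(RintegralD measurableT j1 j2) -(RintegralD measurableT j12 j3).
by apply: le_Rintegral => // w _; exact: h.
Qed.

Lemma msq_ge2 u u1 u2 Y Y1 Y2 (a1 a2 : R) :
  square_integrableV Pr Y -> square_integrableV Pr Y1 ->
  square_integrableV Pr Y2 ->
  (forall w, a1 * nsq (pairing u1 (Y1 w)) - a2 * nsq (pairing u2 (Y2 w)) <=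
    nsq (pairing u (Y w))) ->
  a1 * msq u1 Y1 - a2 * msq u2 Y2 <= msq u Y.
Proof.
move=> sY sY1 sY2 h.
have [i0 _] := msq_quad u sY; have [i1 _] := msq_quad u1 sY1.
have [i2 _] := msq_quad u2 sY2.
have j1 := integrableZl measurableT a1 i1.
have j2 := integrableZl measurableT a2 i2.
have j12 := integrableB measurableT j1 j2.
rewrite /msq -!RintegralZl//.
rewrite -(RintegralB measurableT j1 j2).
by apply: le_Rintegral => // w _; exact: h.
Qed.

(** Noise orthogonal to the past only adds energy; this is what makes a lower bound
    possible. *)
Lemma msq_orthogonal u Y Y' (a : R) :
  square_integrableV Pr Y -> square_integrableV Pr Y' ->
  (forall i j, \int[Pr]_w (Y w i 0 * Y' w j 0) = 0) ->
  msq u (fun w => Y w + a *: Y' w) = msq u Y + a ^+ 2 * msq u Y'.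
Proof.
move=> sY sY' orth.
have saY := square_integrableVZ a sY'.
have [_ ->] := msq_quad u (square_integrableVD sY saY).
have [_ ->] := msq_quad u sY; have [_ ->] := msq_quad u sY'.
rewrite /quad mulr_sumr -big_split /=; apply: eq_bigr => i _.
rewrite mulr_sumr -big_split /=; apply: eq_bigr => j _.
rewrite mulrCA -mulrDr; congr (_ * _).
have i1 := square_integrable_mul (sY i) (sY j).
have i2 := integrableZl measurableT a (square_integrable_mul (sY i) (sY' j)).
have i3 := integrableZl measurableT a (square_integrable_mul (sY j) (sY' i)).
have i4 := integrableZl measurableT (a ^+ 2) (square_integrable_mul (sY' i) (sY' j)).
have i23 := integrableD measurableT i2 i3.
have i234 := integrableD measurableT i23 i4.
transitivity (\int[Pr]_w (Y w i 0 * Y w j 0 + ((a * (Y w i 0 * Y' w j 0) +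
  a * (Y w j 0 * Y' w i 0)) + a ^+ 2 * (Y' w i 0 * Y' w j 0)))).
  by apply: eq_Rintegral => w _; rewrite !mxE; ring.
rewrite (RintegralD measurableT i1 i234) (RintegralD measurableT i23 i4).
rewrite (RintegralD measurableT i2 i3) !RintegralZl//; last 3 first.
- exact: square_integrable_mul.
- exact: square_integrable_mul.
- exact: square_integrable_mul.
by rewrite !orth mulr0 !add0r.
Qed.

End ComplexSecondMoment.

(** * Decay and lower bound of the second moments *)

(** Cayley-Hamilton, with the characteristic polynomial split over the complex numbers. *)
Lemma hurwitz_annihilator (R : realType) (d : nat) (A : 'M[R]_d) : hurwitz A ->
  exists2 s : seq R[i], forall l, l \in s -> complex.Re l < 0 &
    foldr (fun l B => (complexify A - l%:M) *m B) 1%:M s = 0.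
Proof.
case: d A => [|k] B hB; first by exists [::] => //; exact: flatmx0.
have [s] := closed_field_poly_normal (char_poly (complexify B)).
rewrite (monicP (char_poly_monic _)) scale1r => sE.
exists s.
  move=> l ls; apply: hB; rewrite eigenvalue_root_char sE root_prod_XsubC.
  exact: ls.
have := Cayley_Hamilton (complexify B); rewrite sE rmorph_prod /= => <-.
elim: (s) => [|l r IH]; first by rewrite big_nil.
by rewrite big_cons /= IH -mulmxE rmorphB /= horner_mx_X horner_mx_C.
Qed.

(** The cross term between the main part and the O(1/n^2) perturbation is split with
    parameter tau a^2, where a is the step size. It costs tau a^2 s and a^2 C / tau up
    to constants: the second is small against the injected noise a^2 sg for tau
    large, and then the first is small because s is. *)
Lemma noise_absorbs_perturbation (R : realType) (a a' s N sg C h mm bb rho : R) :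
  let tau := 32 * C / sg in
  0 < a -> 0 <= a' -> a' <= 2 * a -> 0 <= s -> 0 <= N -> N <= 1 ->
  1 - 2 * rho * a <= N -> 0 < sg -> 0 < C -> h <= C -> sg / 2 <= mm ->
  s <= sg / (8 * tau) ->
  (1 - tau * a ^+ 2) * N * s - a ^+ 2 * a' ^+ 2 / (tau * a ^+ 2) * h <= bb ->
  (1 - 2 * rho * a) * s + sg / 4 * a ^+ 2 <= bb + a ^+ 2 * mm.
Proof.
move=> tau a0 a'0 aa' s0 N0 N1 Nlow sg0 C0 hC mC sC Eb.
have tau0 : 0 < tau by rewrite /tau divr_gt0// mulr_gt0.
have b1 : (1 - 2 * rho * a) * s <= N * s by rewrite ler_wpM2r.
have b2 : tau * a ^+ 2 * N * s <= a ^+ 2 * (sg / 8).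
  apply: (@le_trans _ _ (tau * a ^+ 2 * s)).
    by rewrite ler_wpM2r// ler_piMr// mulr_ge0 ?sqr_ge0// ltW.
  rewrite [leLHS](_ : _ = a ^+ 2 * (tau * s)); last by ring.
  rewrite ler_wpM2l ?sqr_ge0//.
  have := ler_wpM2l (ltW tau0) sC.
  by rewrite (_ : tau * (sg / (8 * tau)) = sg / 8)//; field; rewrite gt_eqF.
have b3 : a ^+ 2 * a' ^+ 2 / (tau * a ^+ 2) * h <= a ^+ 2 * (sg / 8).
  have -> : a ^+ 2 * a' ^+ 2 / (tau * a ^+ 2) = a' ^+ 2 / tau.
    by field; rewrite !gt_eqF.
  apply: (@le_trans _ _ (a' ^+ 2 / tau * C)).
    by rewrite ler_wpM2l//; apply: divr_ge0; [exact: sqr_ge0|exact: ltW].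
  apply: (@le_trans _ _ ((2 * a) ^+ 2 / tau * C)).
    rewrite ler_wpM2r ?(ltW C0)// ler_wpM2r ?invr_ge0 ?(ltW tau0)//.
    by rewrite !expr2 ler_pM.
  by rewrite /tau le_eqVlt; apply/orP; left; apply/eqP; field; rewrite !gt_eqF.
have b4 : a ^+ 2 * (sg / 2) <= a ^+ 2 * mm by rewrite ler_wpM2l ?sqr_ge0.
rewrite [_ * N * s](_ : _ = N * s - tau * a ^+ 2 * N * s) in Eb; last by ring.
move: b1 b2 b3 b4 Eb.
move: (N * s) (tau * a ^+ 2 * N * s) (_ * h) (a ^+ 2 * mm)
  ((1 - 2 * rho * a) * s) => x1 x2 x3 x4 x5.
rewrite [a ^+ 2 * (sg / 8)](_ : _ = sg * a ^+ 2 / 8); last by ring.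
rewrite [a ^+ 2 * (sg / 2)](_ : _ = sg * a ^+ 2 / 2); last by ring.
rewrite [sg / 4 * a ^+ 2](_ : _ = sg * a ^+ 2 / 4); last by ring.
move: (sg * a ^+ 2) => y; lra.
Qed.

Section ErrorRecursion.
Context {R : realType} {d : nat}.
Context {dO : measure_display} {Omega : measurableType dO}.
Variable Pr : probability Omega R.
Variable A : 'M[R]_d.
Variables c b m H : nat -> Omega -> 'cV[R]_d.
Variables S T : 'I_d -> 'I_d -> R.
Hypothesis sc : forall n, square_integrableV Pr (c n).
Hypothesis sb : forall n, square_integrableV Pr (b n).
Hypothesis sm : forall n, square_integrableV Pr (m n).
Hypothesis sH : forall n, square_integrableV Pr (H n).
Hypothesis orth : forall n i j, \int[Pr]_w (b n w i 0 * m n w j 0) = 0.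
Hypothesis crec : forall n w, c n.+1 w = b n w + step_size n.+1 *: m n w.
Hypothesis bE : forall n w, (0 < n)%N -> b n w = c n w + step_size n.+1 *:
  (A *m c n w - step_size n *: (H n w + A *m H n w)).
Hypothesis mcvg : forall i j,
  (fun n => \int[Pr]_w (m n w i 0 * m n w j 0)) @ \oo --> S i j.
Hypothesis Hcvg : forall i j,
  (fun n => \int[Pr]_w (H n w i 0 * H n w j 0)) @ \oo --> T i j.
Implicit Types (u : 'rV[R[i]]_d) (l : R[i]).

Lemma step_size_ge0 n : 0 <= step_size n :> R.
Proof. by rewrite invr_ge0. Qed.

Lemma step_size_cvg0 : (fun n => step_size n : R) @ \oo --> (0 : R).
Proof. by rewrite -cvg_shiftS; exact: cvg_harmonic. Qed.

Lemma msq_noise_cvg u : (fun n => msq Pr u (m n)) @ \oo --> quad u S.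
Proof.
rewrite (_ : (fun n => _) = fun n => quad u (fun i j => \int[Pr]_w (m n w i 0 * m n w j 0))).
  exact: quad_cvg.
by apply/funext => n; have [_ ->] := msq_quad u (sm n).
Qed.

Lemma msq_H_cvg u : (fun n => msq Pr u (H n)) @ \oo --> quad u T.
Proof.
rewrite (_ : (fun n => _) = fun n => quad u (fun i j => \int[Pr]_w (H n w i 0 * H n w j 0))).
  exact: quad_cvg.
by apply/funext => n; have [_ ->] := msq_quad u (sH n).
Qed.

Lemma cvg_near_le (s : nat -> R) (x : R) : s @ \oo --> x -> \forall n \near \oo, s n <= x + 1.
Proof. by move=> sl; apply: (cvgr_le _ sl); rewrite ltrDl. Qed.

Lemma msq_corrected_rec u n :
  msq Pr u (c n.+1) = msq Pr u (b n) + step_size n.+1 ^+ 2 * msq Pr u (m n).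
Proof.
rewrite -(msq_orthogonal u (step_size n.+1) (sb n) (sm n) (orth n)).
by congr msq; apply/funext => w; exact: crec.
Qed.

(** If [u'] is what prevents [u] from being a left eigenvector, the form [u] is
    multiplied by 1 + l/(n+1) and receives [u'] as an input. *)
Lemma pairing_predicted u u' l n w : (0 < n)%N ->
  u *m complexify A = l *: u + u' ->
  pairing u (b n w) = (1 + (step_size n.+1)%:C%C * l) * pairing u (c n w) +
    (step_size n.+1)%:C%C * (pairing u' (c n w) -
      (step_size n)%:C%C * pairing (u + u *m complexify A) (H n w)).
Proof.
move=> n0 uA; rewrite (bE w n0).
rewrite pairingD pairingZ pairingD -scaleN1r !pairingZ pairingD !pairingM.
rewrite pairingDl {1}uA pairingDl pairingZl.
have -> : (-1)%:C%C = -1 :> R[i] by rewrite rmorphN1.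
ring.
Qed.

Lemma nsq_1D (a : R) l :
  nsq (1 + a%:C%C * l) = 1 + 2 * a * complex.Re l + a ^+ 2 * nsq l.
Proof. by case: l => x y; rewrite /nsq /=; ring. Qed.

(** From |1 + a l|^2 = 1 + 2 a Re l + a^2 |l|^2: half of the negative first order term
    absorbs the second order one as soon as the step size a is small. *)
Lemma nsq_factor_le l : complex.Re l < 0 -> \forall n \near \oo,
  [/\ (0 < n)%N, 0 < - complex.Re l / 2 * step_size n.+1 < 1 &
   nsq (1 + (step_size n.+1)%:C%C * l) <= (1 - - complex.Re l / 2 * step_size n.+1) ^+ 2].
Proof.
move=> l0; set e := - complex.Re l / 2.
have e0 : 0 < e by rewrite /e divr_gt0 ?oppr_gt0.
have sz := step_size_cvg0; rewrite -cvg_shiftS in sz.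
near=> n.
have n0 : (0 < n)%N by near: n; exact: nbhs_infty_gt.
have a0 : 0 < step_size n.+1 :> R by rewrite invr_gt0.
have h1 : step_size n.+1 <= (2 * e)^-1.
  by near: n; apply: (cvgr_le _ sz); rewrite invr_gt0 mulr_gt0.
have h2 : step_size n.+1 <= 2 * e / (nsq l + 1).
  near: n; apply: (cvgr_le _ sz); apply: divr_gt0; first exact: mulr_gt0.
  by rewrite ltr_wpDl ?nsq_ge0.
move: h1 h2; set a := step_size n.+1 => h1 h2.
split => //.
  rewrite mulr_gt0//=.
  have e2 : 0 < 2 * e by rewrite mulr_gt0.
  have h3 : a * (2 * e) <= 1 by rewrite -(ler_pdivlMr _ _ e2) mul1r.
  have ea : 0 < e * a by rewrite mulr_gt0.
  lra.
move: h2; rewrite ler_pdivlMr ?ltr_wpDl ?nsq_ge0// => h2.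
have lE : complex.Re l = - (2 * e) by rewrite /e; field.
rewrite nsq_1D.
have h3 : a * (a * (nsq l + 1)) <= a * (2 * e) by rewrite ler_wpM2l// ltW.
have a2 : 0 <= a ^+ 2 by exact: sqr_ge0.
have ea2 : 0 <= (e * a) ^+ 2 by exact: sqr_ge0.
rewrite lE; nra.
Unshelve. all: by end_near. Qed.

Lemma msq_corrected_cvg0_step u u' l : complex.Re l < 0 ->
  u *m complexify A = l *: u + u' ->
  (fun n => msq Pr u' (c n)) @ \oo --> (0 : R) ->
  (fun n => msq Pr u (c n)) @ \oo --> (0 : R).
Proof.
move=> l0 uA u'0; set e := - complex.Re l / 2.
have e0 : 0 < e by rewrite /e divr_gt0 ?oppr_gt0.
pose Cm := quad u S + 1; pose CH := quad (u + u *m complexify A) T + 1.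
pose bet n := e^-1 * (2 * msq Pr u' (c n) + 2 * step_size n ^+ 2 * CH) +
  step_size n.+1 * Cm.
have sz := step_size_cvg0; have sz' := sz; rewrite -cvg_shiftS in sz'.
apply: (@cvg0_contraction _ e _ bet) => //.
- rewrite (_ : 0 = e^-1 * (2 * 0 + 2 * 0 ^+ 2 * CH) + 0 * Cm); last first.
    by rewrite expr0n /= !(mulr0, mul0r, addr0).
  apply: cvgD; last by exact: (cvgM sz' (cvg_cst _)).
  apply: (cvgM (cvg_cst _) _); apply: cvgD; first exact: (cvgM (cvg_cst _) u'0).
  apply: (cvgM _ (cvg_cst _)); apply: (cvgM (cvg_cst _)).
  by rewrite expr2; exact: (cvgM sz sz).
- by move=> n; exact: msq_ge0.
have near_m : \forall n \near \oo, msq Pr u (m n) <= Cm.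
  exact: (cvg_near_le (@msq_noise_cvg u)).
have near_H : \forall n \near \oo, msq Pr (u + u *m complexify A) (H n) <= CH.
  exact: (cvg_near_le (@msq_H_cvg _)).
near=> n.
have [n0 ea01 fac] : [/\ (0 < n)%N, 0 < e * step_size n.+1 < 1 &
    nsq (1 + (step_size n.+1)%:C%C * l) <= (1 - e * step_size n.+1) ^+ 2].
  by near: n; exact: nsq_factor_le.
have mC : msq Pr u (m n) <= Cm by near: n.
have HC : msq Pr (u + u *m complexify A) (H n) <= CH by near: n.
have a0 : 0 < step_size n.+1 :> R by rewrite invr_gt0.
have nE : n.+1%:R = (step_size n.+1)^-1 :> R by rewrite invrK.
rewrite msq_corrected_rec nE invrK; move: ea01 fac mC HC a0.
rewrite /bet; set a := step_size n.+1; set a' := step_size n => ea01 fac mC HC a0.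
have Eb : msq Pr u (b n) <= (1 - e * a) * msq Pr u (c n) +
    (a / e * 2) * msq Pr u' (c n) + (a / e * (2 * a' ^+ 2)) *
      msq Pr (u + u *m complexify A) (H n).
  apply: msq_le3 => // w; rewrite (pairing_predicted w n0 uA) -/a -/a'.
  apply: (le_trans (nsq_contraction _ _ ea01 fac)); rewrite -addrA lerD2l.
  have a'E : pairing u' (c n w) - a'%:C%C * pairing (u + u *m complexify A) (H n w) =
      pairing u' (c n w) + (- a')%:C%C * pairing (u + u *m complexify A) (H n w).
    by rewrite rmorphN mulNr.
  have := nsq_add_le2 (pairing u' (c n w))
    ((- a')%:C%C * pairing (u + u *m complexify A) (H n w)).
  rewrite a'E (nsqM a%:C%C) nsqR (nsqM (- a')%:C%C) nsqR sqrrN.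
  set X := nsq (pairing u' _); set Y := nsq (pairing (_ + _) _); set W := nsq (_ + _).
  move=> le; have -> : a ^+ 2 * W / (e * a) = a / e * W by field; rewrite !gt_eqF.
  have ae0 : 0 < a / e by rewrite divr_gt0.
  rewrite [leRHS](_ : _ = a / e * (2 * X + 2 * (a' ^+ 2 * Y))); last by ring.
  by rewrite ler_wpM2l// ltW.
apply: (le_trans (lerD Eb (lexx _))).
have t1 : a ^+ 2 * msq Pr u (m n) <= a ^+ 2 * Cm by rewrite ler_wpM2l ?sqr_ge0.
have t2 : a / e * (2 * a' ^+ 2) * msq Pr (u + u *m complexify A) (H n) <=
    a / e * (2 * a' ^+ 2) * CH.
  apply: ler_wpM2l => //; apply: mulr_ge0; first by apply: divr_ge0; exact: ltW.
  by rewrite mulr_ge0 ?sqr_ge0.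
have E3 : (e^-1 * (2 * msq Pr u' (c n) + 2 * a' ^+ 2 * CH) + a * Cm) * a =
    a / e * 2 * msq Pr u' (c n) + a / e * (2 * a' ^+ 2) * CH + a ^+ 2 * Cm.
  by field; rewrite gt_eqF.
by rewrite E3 -!addrA lerD2l lerD2l lerD.
Unshelve. all: by end_near. Qed.

Lemma msq0 (Y : Omega -> 'cV[R]_d) : msq Pr 0 Y = 0.
Proof.
have p0 w : nsq (pairing 0 (Y w)) = 0.
  by rewrite /pairing mul0mx mxE /nsq /= expr0n addr0.
rewrite /msq; under eq_Rintegral do rewrite p0.
by rewrite Rintegral_cst// mul0r.
Qed.

(** Each factor of the annihilating product that is removed from [u] turns into the
    input of the previous step. *)
Lemma msq_corrected_cvg0_seq (s : seq R[i]) u : (forall l, l \in s -> complex.Re l < 0) ->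
  u *m foldr (fun l B => (complexify A - l%:M) *m B) 1%:M s = 0 ->
  (fun n => msq Pr u (c n)) @ \oo --> (0 : R).
Proof.
elim: s u => [|l s IH] u s0 /=.
  rewrite mulmx1 => ->; under eq_fun do rewrite msq0; exact: cvg_cst.
rewrite mulmxA => us0.
apply: (@msq_corrected_cvg0_step u (u *m (complexify A - l%:M)) l).
- by apply: s0; rewrite mem_head.
- by rewrite mulmxBr mul_mx_scalar addrC subrK.
- by apply: IH => // k ks; apply: s0; rewrite inE ks orbT.
Qed.

Lemma msq_corrected_cvg0 u : hurwitz A ->
  (fun n => msq Pr u (c n)) @ \oo --> (0 : R).
Proof.
move=> hA.
have [s s0 prod0] := hurwitz_annihilator hA.
by apply: (msq_corrected_cvg0_seq s0); rewrite prod0 mulmx0.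
Qed.

Lemma quad_noise_ge0 u : 0 <= quad u S.
Proof.
have := @msq_noise_cvg u => h; rewrite -(cvg_lim _ h)//.
apply: limr_ge; first by apply/cvg_ex; eexists; exact: h.
by near=> n; exact: msq_ge0.
Unshelve. all: by end_near. Qed.

(** The noise injected at each step dominates the perturbations, because the second
    moment itself tends to 0; what remains is the factor
    |1 + l/(n+1)|^2 >= 1 - 2 rho/(n+1). *)
Lemma msq_corrected_lower u l (rho : R) : hurwitz A ->
  complex.Re l < 0 -> - rho = complex.Re l ->
  u *m complexify A = l *: u -> 0 < quad u S ->
  exists2 delta : R, 0 < delta & \forall n \near \oo,
    (1 - (2 * rho) / n.+1%:R) * msq Pr u (c n) + delta * step_size n.+1 ^+ 2 <=
    msq Pr u (c n.+1).
Proof.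
move=> hA l0 lrho uA sg0; set sg := quad u S in sg0.
have s0 := msq_corrected_cvg0 u hA.
pose CH := quad (u + u *m complexify A) T + 1.
(* for this tau, 4 a^2 (|CH| + 1) / tau = a^2 sg / 8 *)
pose tau := 32 * (`|CH| + 1) / sg.
have CH1 : 0 < `|CH| + 1 by rewrite ltr_wpDl.
have tau0 : 0 < tau by rewrite /tau divr_gt0// mulr_gt0.
(* sg/2 from the noise, less sg/8 for each of the two perturbation terms *)
exists (sg / 4); first by rewrite divr_gt0.
have uA' : u *m complexify A = l *: u + 0 by rewrite addr0.
have near_m : \forall n \near \oo, sg / 2 <= msq Pr u (m n).
  apply: (cvgr_ge _ (@msq_noise_cvg u)); rewrite -/sg; lra.
have near_H : \forall n \near \oo, msq Pr (u + u *m complexify A) (H n) <= CH.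
  exact: (cvg_near_le (@msq_H_cvg _)).
have near_s : \forall n \near \oo, msq Pr u (c n) <= sg / (8 * tau).
  by apply: (cvgr_le _ s0); rewrite divr_gt0// mulr_gt0.
near=> n.
have [n0 ea01 fac] : [/\ (0 < n)%N, 0 < - complex.Re l / 2 * step_size n.+1 < 1 &
    nsq (1 + (step_size n.+1)%:C%C * l) <= (1 - - complex.Re l / 2 * step_size n.+1) ^+ 2].
  by near: n; exact: nsq_factor_le.
have mC : sg / 2 <= msq Pr u (m n) by near: n.
have HC : msq Pr (u + u *m complexify A) (H n) <= CH by near: n.
have sC : msq Pr u (c n) <= sg / (8 * tau) by near: n.
have a0 : 0 < step_size n.+1 :> R by rewrite invr_gt0.
have aa' : step_size n <= 2 * step_size n.+1 :> R.
  rewrite /step_size ler_pdivlMr ?ltr0n// mulrC ler_pdivrMr ?ltr0n//.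
  by rewrite -natrM ler_nat mul2n -addnn -addn1 leq_add2l.
have a'0 : 0 <= step_size n :> R := step_size_ge0 n.
have nE : n.+1%:R = (step_size n.+1)^-1 :> R by rewrite invrK.
have sn0 := msq_ge0 Pr u (c n).
rewrite msq_corrected_rec nE invrK; move: ea01 fac mC HC sC a0 aa' a'0.
set a := step_size n.+1; set a' := step_size n; set s := msq Pr u (c n) in sn0 *.
move=> ea01 fac mC HC sC a0 aa' a'0.
set N := nsq (1 + a%:C%C * l) in fac.
have t0 : 0 < tau * a ^+ 2 by rewrite mulr_gt0// exprn_gt0.
have Eb : (1 - tau * a ^+ 2) * N * s - (a ^+ 2 * a' ^+ 2 / (tau * a ^+ 2)) *
    msq Pr (u + u *m complexify A) (H n) <= msq Pr u (b n).
  apply: msq_ge2 => // w; rewrite (pairing_predicted w n0 uA') -/a -/a'.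
  apply: le_trans (nsq_add_ge _ _ t0).
  have p0 : pairing (0 : 'rV[R[i]]_d) (c n w) = 0 by rewrite /pairing mul0mx mxE.
  rewrite p0 sub0r !nsqM nsqN nsqM !nsqR -/N.
  by rewrite le_eqVlt; apply/orP; left; apply/eqP; field; rewrite !gt_eqF.
have N1 : N <= 1.
  have /andP[k0 k1] := ea01.
  by apply: (le_trans fac); rewrite exprn_ile1// ?subr_ge0 ?gerBl ltW.
have Nlow : 1 - 2 * rho * a <= N.
  rewrite /N nsq_1D -lrho (_ : 1 + _ = 1 - 2 * rho * a); last by ring.
  by rewrite lerDl mulr_ge0 ?sqr_ge0 ?nsq_ge0.
have N0 : 0 <= N by exact: nsq_ge0.
apply: (noise_absorbs_perturbation a0 a'0 aa' sn0 N0 N1 Nlow sg0 CH1 _ mC _ Eb).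
- by apply: (le_trans HC); rewrite (le_trans (ler_norm _))// lerDl.
- exact: sC.
Unshelve. all: by end_near. Qed.

End ErrorRecursion.

(** * Positivity of the limiting noise covariance *)

Section PositiveSemidefinite.
Context {R : realType} {d : nat}.
Variable M : 'M[R]_d.
Hypothesis sym : M^T = M.
Hypothesis psd : forall x : 'rV[R]_d, 0 <= (x *m M *m x^T) 0 0.

(** With y = x M, moving from [x] by - t y changes the form by - 2 t |y|^2 + O(t^2),
    which would be negative for small t > 0. *)
Lemma psd_kernel (x : 'rV[R]_d) : (x *m M *m x^T) 0 0 = 0 -> x *m M = 0.
Proof.
have [y yE] : exists y, y = x *m M by exists (x *m M).
rewrite -yE => x0.
pose q := (y *m M *m y^T) 0 0; pose s := (y *m y^T) 0 0.
have sE : s = \sum_i y 0 i ^+ 2.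
  by rewrite /s mxE; apply: eq_bigr => i _; rewrite [X in _ * X]mxE expr2.
have s0 : 0 <= s by rewrite sE sumr_ge0// => i _; exact: sqr_ge0.
have q0 : 0 <= q := psd y.
have E1 : (y *m M *m x^T) 0 0 = s.
  transitivity ((y *m M *m x^T)^T 0 0); first by rewrite [RHS]mxE.
  by rewrite !trmx_mul trmxK sym mulmxA -yE.
(* the denominator q + 1 keeps t defined when the form vanishes at y *)
pose t := s / (q + 1).
have E : ((x - t *: y) *m M *m (x - t *: y)^T) 0 0 = - (2 * t * s) + t ^+ 2 * q.
  have -> : (x - t *: y)^T = x^T - t *: y^T by rewrite linearB /= linearZ.
  rewrite mulmxBl mulmxBr !mulmxBl -!scalemxAr -!scalemxAl -yE.
  move: x0 E1; rewrite /q /s.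
  move: (y *m x^T) (y *m M *m x^T) (y *m y^T) (y *m M *m y^T) => a b e f a0 be.
  by rewrite !mxE a0 be; ring.
have q1 : 0 < q + 1 by rewrite ltr_wpDl.
have sz : s = 0.
  have := psd (x - t *: y); rewrite E /t.
  have -> : - (2 * (s / (q + 1)) * s) + (s / (q + 1)) ^+ 2 * q =
      - (s ^+ 2 * (q + 2) / (q + 1) ^+ 2) by field; rewrite gt_eqF.
  rewrite oppr_ge0 => h; apply/eqP; rewrite -sqrf_eq0 eq_le sqr_ge0 andbT.
  move: h; rewrite pmulr_lle0 ?invr_gt0 ?exprn_gt0// pmulr_lle0//; lra.
apply/rowP => i; rewrite [RHS]mxE; apply/eqP; rewrite -sqrf_eq0; apply/eqP.
move/eqP: sz; rewrite sE psumr_eq0; last by move=> k _; exact: sqr_ge0.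
by move=> /allP /(_ i); rewrite mem_index_enum => /(_ isT) /eqP.
Qed.

End PositiveSemidefinite.

Section QuadraticForm.
Context {R : realType} {d : nat}.
Implicit Types (u : 'rV[R[i]]_d) (M : 'M[R]_d) (x : 'rV[R]_d).

Lemma quad_mx u M : quad u (fun i j => M i j) =
  (map_mx (@complex.Re R) u *m M *m (map_mx (@complex.Re R) u)^T) 0 0 +
  (map_mx (@complex.Im R) u *m M *m (map_mx (@complex.Im R) u)^T) 0 0.
Proof.
have h (x : 'rV[R]_d) : (x *m M *m x^T) 0 0 = \sum_i \sum_j x 0 i * x 0 j * M i j.
  rewrite mxE exchange_big /=; apply: eq_bigr => j _.
  rewrite !mxE mulr_suml; apply: eq_bigr => i _; ring.
rewrite /quad !h -big_split /=; apply: eq_bigr => i _.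
rewrite -big_split /=; apply: eq_bigr => j _.
by rewrite !mxE mulrDl.
Qed.

(** If the form vanishes at [v], then M annihilates its real and imaginary parts. *)
Lemma quad_gt0 (v : 'cV[R[i]]_d) M : M^T = M ->
  (forall u, 0 <= quad u (fun i j => M i j)) ->
  complexify M *m v != 0 -> 0 < quad v^T (fun i j => M i j).
Proof.
move=> sym qpsd Mv; rewrite lt_neqAle qpsd andbT; apply: contra_neq Mv => q0.
have psd x : 0 <= (x *m M *m x^T) 0 0.
  have := qpsd (map_mx (real_complex R) x); rewrite quad_mx.
  have -> : map_mx (@complex.Re R) (map_mx (real_complex R) x) = x.
    by apply/matrixP => i j; rewrite !mxE.
  have -> : map_mx (@complex.Im R) (map_mx (real_complex R) x) = 0.
    by apply/matrixP => i j; rewrite !mxE.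
  by rewrite !mul0mx [X in _ + X]mxE addr0.
move/esym: q0; rewrite quad_mx.
set a := map_mx (@complex.Re R) _; set b := map_mx (@complex.Im R) _ => q0.
have [a0 b0] : (a *m M *m a^T) 0 0 = 0 /\ (b *m M *m b^T) 0 0 = 0.
  by have := psd a; have := psd b; lra.
have Ma := psd_kernel sym psd a0; have Mb := psd_kernel sym psd b0.
apply/colP => i; rewrite [RHS]mxE mxE.
have Mai : \sum_j a 0 j * M j i = 0.
  by have := congr1 (fun B : 'rV_d => B 0 i) Ma; rewrite !mxE.
have Mbi : \sum_j b 0 j * M j i = 0.
  by have := congr1 (fun B : 'rV_d => B 0 i) Mb; rewrite !mxE.
have symM j : M i j = M j i by rewrite -{1}sym mxE.
apply/eqP; rewrite eq_complex; apply/andP; split; apply/eqP => /=.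
- rewrite -Mai raddf_sum; apply: eq_bigr => j _; rewrite !mxE symM.
  by case: (v j 0) => x y /=; rewrite mul0r subr0 mulrC.
- rewrite -Mbi raddf_sum; apply: eq_bigr => j _; rewrite !mxE symM.
  by case: (v j 0) => x y /=; rewrite mul0r addr0 mulrC.
Qed.

Lemma nsq_pairing_le u : exists2 C : R, 0 < C &
  forall y : 'cV[R]_d, nsq (pairing u y) <= C * \sum_i y i 0 ^+ 2.
Proof.
have h (x : 'I_d -> R) (y : 'cV[R]_d) :
    (\sum_i x i * y i 0) ^+ 2 <= (\sum_i `|x i|) ^+ 2 * \sum_i y i 0 ^+ 2.
  have Q0 : 0 <= \sum_i y i 0 ^+ 2 by rewrite sumr_ge0// => i _; exact: sqr_ge0.
  rewrite -[X in _ * X](sqr_sqrtr Q0) -exprMn -[leLHS](real_normK (num_real _)).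
  rewrite ler_sqr ?nnegrE ?mulr_ge0 ?sqrtr_ge0 ?sumr_ge0//.
  rewrite (le_trans (ler_norm_sum _ _ _))// mulr_suml ler_sum// => i _.
  rewrite normrM ler_wpM2l// -sqrtr_sqr ler_wsqrtr//.
  by rewrite (bigD1 i)//= lerDl sumr_ge0// => j _; exact: sqr_ge0.
exists ((\sum_i `|complex.Re (u 0 i)|) ^+ 2 + (\sum_i `|complex.Im (u 0 i)|) ^+ 2 + 1).
  by rewrite ltr_wpDl// addr_ge0 ?sqr_ge0.
move=> y; rewrite nsq_pairing !mulrDl mul1r.
have Q0 : 0 <= \sum_i y i 0 ^+ 2 by rewrite sumr_ge0// => i _; exact: sqr_ge0.
have := h (fun i => complex.Re (u 0 i)) y; have := h (fun i => complex.Im (u 0 i)) y.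
by move=> h1 h2; rewrite -[leLHS]addr0 lerD// lerD.
Qed.

Lemma nsq_pairing_delta i (y : 'cV[R]_d) :
  nsq (pairing (delta_mx 0 i) y) = y i 0 ^+ 2.
Proof. by rewrite /pairing -rowE !mxE nsqR. Qed.

End QuadraticForm.

(** * From second moments to the rate of the mean square error *)

Section Rate.
Context {R : realType} {d : nat}.
Context {dO : measure_display} {Omega : measurableType dO}.
Variable Pr : probability Omega R.
Implicit Types (Y : Omega -> 'cV[R]_d) (u : 'rV[R[i]]_d).

Definition mean_square Y : R := \sum_i \int[Pr]_w (Y w i 0 ^+ 2).

Lemma mean_square_ge0 Y : 0 <= mean_square Y.
Proof. by apply: sumr_ge0 => i _; apply: Rintegral_ge0 => w _; exact: sqr_ge0. Qed.

Lemma expectation_euclidean_norm Y : square_integrableV Pr Y ->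
  ('E_Pr[fun w => (euclidean_norm (Y w) ^+ 2)%R] = (mean_square Y)%:E)%E.
Proof.
move=> sY; have iY i := (sY i).2.
have [isum Esum] := Rintegral_sum (index_enum 'I_d) iY.
rewrite unlock /mean_square -Esum /Rintegral fineK; last exact: integrable_fin_num.
apply: eq_integral => w _; rewrite /euclidean_norm sqr_sqrtr//.
by apply: sumr_ge0 => i _; exact: sqr_ge0.
Qed.

Lemma mean_squareE Y :
  mean_square Y = \sum_i msq Pr (delta_mx 0 i) Y.
Proof.
apply: eq_bigr => i _; apply: eq_Rintegral => w _.
by rewrite nsq_pairing_delta.
Qed.

Lemma msq_le_mean_square u : exists2 C : R, 0 < C &
  forall Y, square_integrableV Pr Y -> msq Pr u Y <= C * mean_square Y.
Proof.
have [C C0 le] := nsq_pairing_le u; exists C => // Y sY.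
have iY i := (sY i).2.
have [isum Esum] := Rintegral_sum (index_enum 'I_d) iY.
rewrite /mean_square -Esum -RintegralZl//; apply: le_Rintegral => //.
- by have [] := msq_quad u sY.
- exact: (integrableZl measurableT C isum).
Qed.

End Rate.

(** n^r e_n = n^(r - p) (n^p e_n) for r > p. *)
Lemma cvg0_no_faster_than_real (R : realType) (e : nat -> R) (p kappa : R) :
  0 < kappa -> (forall n, 0 <= e n) -> e @ \oo --> (0 : R) ->
  (\forall n \near \oo, kappa <= n%:R `^ p * e n) ->
  cvg0_no_faster_than (fun n => (e n)%:E) p.
Proof.
move=> k0 e0 ecvg low; split; first by apply: cvg_EFin => //; near=> n.
move=> r pr.
have rp0 : 0 < r - p by rewrite subr_gt0.
rewrite (_ : (fun n => _) = (fun n => (n%:R `^ r * e n)%:E)); last first.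
  by apply/funext => n; rewrite EFinM gee0_abs// lee_fin.
apply/cvgeryP/cvgryPge => B.
have large := cvgn_powR_pinfty rp0 (`|B| / kappa).
near=> n.
have h1 : kappa <= n%:R `^ p * e n by near: n.
have h2 : `|B| / kappa <= n%:R `^ (r - p) by near: n.
have n0 : n%:R != 0 :> R.
  by rewrite pnatr_eq0 -lt0n; near: n; exact: nbhs_infty_gt.
rewrite -(subrK p r) powRD; last by rewrite n0 implybT.
rewrite -mulrA; apply: (@le_trans _ _ (`|B| / kappa * kappa)).
  by rewrite divfK ?gt_eqF// ler_norm.
apply: ler_pM => //; first by rewrite divr_ge0// ltW.
exact: ltW.
Unshelve. all: by end_near. Qed.

Unset Implicit Arguments.
Set Strict Implicit.

Theorem corollary2p5 (R : realType) (Z : ptopologicalType) (V : Z -> R)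
  (P : R.-pker (borel Z) ~> (borel Z)) (pi : probability (borel Z) R)
  (dO : measure_display) (Omega : measurableType dO) (Pr : probability Omega R)
  (Phi : nat -> Omega -> Z) (z0 : Z)
  (dS : measure_display) (OmegaS : measurableType dS)
  (PrS : probability OmegaS R) (PhiS : int -> OmegaS -> Z)
  (d : nat) (A : 'M[R]_d) (f : Z -> 'cV[R]_d) (theta0 : 'cV[R]_d)
  (lambda : R[i]) (rho0 : R) (v : 'cV[R[i]]_d)
  (hZ : polish R Z)
  (hVmeas : measurable_fun [set: borel Z] V)
  (hV1 : forall z, 1 <= V z)
  (hPhi : markov_chain P Pr succn Phi)
  (hPhi0 : forall w, Phi 0%N w = z0)
  (hA1 : V_uniformly_ergodic P V pi)
  (hA2 : hurwitz A)
  (hfmeas : forall i, measurable_fun [set: borel Z] (fun z => f z i 0))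
  (hfV : forall i, (normV V (fun z => (f z i 0 ^+ 2)%R) < +oo)%E)
  (hfpi : forall i, (\int[pi]_z (f z i 0%R)%:E = 0)%E)
  (hPhiS : stationary_version P PrS pi PhiS)
  (hlambda : - rho0 = complex.Re lambda)
  (hrho0 : - rho0 > - (1 / 2))
  (hv0 : v != 0)
  (hv : v^T *m complexify A = lambda *: v^T)
  (hSigma : complexify (asymptotic_cov PrS PhiS f) *m v != 0) :
  cvg0_no_faster_than
    (fun n => 'E_Pr[fun w =>
       (euclidean_norm
          (sa_iter A (fun k => f (Phi k w)) theta0 n) ^+ 2)%R]%E)
    (2 * rho0).
Proof.
have [K sf] := choice (fun i => normV_sqrtV_bounded hV1 (hfmeas i) (hfV i)).
have pif0 i : \int[pi]_z f z i 0 = 0 by rewrite /Rintegral hfpi.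
have vT0 : v^T != 0 by rewrite -trmx0 (inj_eq trmx_inj).
have l0 : complex.Re lambda < 0.
  by apply: hA2; apply/eigenvalueP; exists v^T.
have rho_gt0 : 0 < rho0 by rewrite -oppr_lt0 hlambda.
pose th := theta Phi A f theta0.
pose c := corrected P Phi A f theta0.
pose H n w := poissonH P f (Phi n w).
pose Sig := asymptotic_cov PrS PhiS f.
have sth n := square_integrable_theta hVmeas hV1 hA1 hPhi hPhi0 A theta0 sf n.
have sc n := square_integrable_corrected hVmeas hV1 hA1 hPhi hPhi0 A theta0 sf pif0 n.
have sb n := square_integrable_predicted hVmeas hV1 hA1 hPhi hPhi0 A theta0 sf pif0 n.
have sm n := square_integrable_noise hVmeas hV1 hA1 hPhi hPhi0 sf pif0 n.
have sH n := square_integrable_poissonH hVmeas hV1 hA1 hPhi hPhi0 sf pif0 n.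
have ab n i : adapted Phi n (fun w => predicted P Phi A f theta0 n w i 0).
  exact: (adapted_predicted hV1 hA1 A theta0 sf pif0 (n := n) i).
have orth n i j : \int[Pr]_w (predicted P Phi A f theta0 n w i 0 *
    noise P Phi f n w j 0) = 0.
  exact: (noise_orthogonal hVmeas hV1 hA1 hPhi hPhi0 sf pif0 j (ab n i) (sb n i)).
pose S i j := \int[pi]_z (poissonV P f z i 0 * poissonV P f z j 0) -
  \int[pi]_z (poissonH P f z i 0 * poissonH P f z j 0).
pose T i j := \int[pi]_z (poissonH P f z i 0 * poissonH P f z j 0).
have mcvg i j : (fun n => \int[Pr]_w (noise P Phi f n w i 0 * noise P Phi f n w j 0))
    @ \oo --> S i j.
  exact: (@noise_moment_cvg _ _ _ _ _ hVmeas hV1 hA1 _ _ _ _ _ hPhi hPhi0 _ _ _ sf pif0).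
have Hcvg i j : (fun n => \int[Pr]_w (H n w i 0 * H n w j 0)) @ \oo --> T i j.
  exact: (@poissonH_moment_cvg _ _ _ _ _ hV1 hA1 _ _ _ _ _ hPhi hPhi0 _ _ _ sf pif0).
have SigE i j : Sig i j = S i j.
  rewrite /Sig (asymptotic_covE hVmeas hV1 hA1 hPhiS sf pif0) /S.
  congr (_ - _); apply: eq_Rintegral => z _; first by rewrite /poissonV !mxE.
  by rewrite /poissonH /poissonV !mxE.
have crec := corrected_rec P Phi A f theta0.
have bE := @predictedE _ _ P _ _ Phi _ A f theta0.
have upper u := msq_corrected_cvg0 sc sb sm sH orth crec bE mcvg Hcvg u hA2.
have quadE u : quad u (fun i j => Sig i j) = quad u S.
  by apply: eq_bigr => i _; apply: eq_bigr => j _; rewrite SigE.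
have symSig : Sig^T = Sig.
  apply/matrixP => i j; rewrite mxE !SigE /S.
  by congr (_ - _); apply: eq_Rintegral => z _; rewrite mulrC.
have sg0 : 0 < quad v^T S.
  rewrite -quadE; apply: quad_gt0 => // u; rewrite quadE.
  exact: quad_noise_ge0 sm mcvg u.
(* from time N0 on, one step makes the second moment positive, and it stays so *)
have [delta delta0 [N0 _ low]] := msq_corrected_lower sc sb sm sH orth crec bE mcvg
  Hcvg hA2 l0 hlambda hv sg0.
have stepH n w : c n w = th n w + step_size n *: H n w by [].
(* the iterates and the corrected ones differ by O(1/n) in root mean square,
   which is negligible against n^(- rho0) *)
have th_le u n : msq Pr u (th n) <= 2 * msq Pr u (c n) +
    2 * step_size n ^+ 2 * msq Pr u (H n) + 0 * msq Pr u (H n).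
  apply: (msq_le3 (sth n) (sc n) (sH n) (sH n)) => w; rewrite mul0r addr0.
  have := nsq_add_le2 (pairing u (c n w)) (- (step_size n)%:C%C * pairing u (H n w)).
  rewrite mulNr nsqN nsqM nsqR mulrA; congr (nsq _ <= _).
  by rewrite stepH pairingD pairingZ addrK.
have c_le u n : 2^-1 * msq Pr u (c n) - step_size n ^+ 2 * msq Pr u (H n) <=
    msq Pr u (th n).
  apply: (msq_ge2 (sth n) (sc n) (sH n)) => w.
  have := nsq_add_le2 (pairing u (th n w)) ((step_size n)%:C%C * pairing u (H n w)).
  rewrite -pairingZ -pairingD -stepH pairingZ nsqM nsqR.
  move: (nsq (pairing u (c n w))) (nsq (pairing u (th n w)))
    (step_size n ^+ 2 * _) => x y z; lra.
have sz := @step_size_cvg0 R.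
have Hbound u := @msq_H_cvg _ _ _ _ Pr H T sH Hcvg u.
have th0 u : (fun n => msq Pr u (th n)) @ \oo --> (0 : R).
  apply: (@cvg0_dominated _ _ (fun n => 2 * msq Pr u (c n) +
    2 * step_size n ^+ 2 * msq Pr u (H n))).
    near=> n; rewrite ger0_norm ?msq_ge0//.
    by have := th_le u n; rewrite mul0r addr0.
  rewrite (_ : 0 = 2 * 0 + 2 * (0 * 0) * quad u T); last by rewrite !(mulr0, mul0r) addr0.
  apply: cvgD; first exact: (cvgM (cvg_cst _) (upper u)).
  apply: cvgM (Hbound u); apply: (cvgM (cvg_cst _)).
  exact: (cvgM sz sz).
rewrite (_ : (fun n => _) = fun n => (mean_square Pr (th n))%:E); last first.
  by apply/funext => n; exact: expectation_euclidean_norm (sth n).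
have [C C0 leC] := msq_le_mean_square Pr v^T.
have p01 : 0 < 2 * rho0 < 1 by apply/andP; split; lra.
pose s n := msq Pr v^T (c n).
have contr n : 0 <= 1 - 2 * rho0 / n.+1%:R.
  have [p0 p1] := andP p01.
  by rewrite subr_ge0 ler_pdivrMr ?ltr0n// mul1r (le_trans (ltW p1))// ler1n.
have lowS n : (N0.+1 <= n)%N -> (1 - 2 * rho0 / n.+1%:R) * s n <= s n.+1.
  move=> Nn; apply: le_trans (low n (ltnW Nn)).
  by rewrite lerDl mulr_ge0 ?sqr_ge0// ltW.
have sN : 0 < s N0.+1.
  apply: lt_le_trans (low N0 (leqnn _)).
  rewrite ltr_wpDl ?mulr_ge0 ?msq_ge0// mulr_gt0// exprn_gt0//.
  by rewrite invr_gt0 ltr0n.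
pose k0 := s N0.+1 * N0.+1%:R `^ (2 * rho0).
have k0_gt0 : 0 < k0 by rewrite mulr_gt0// powR_gt0// ltr0n.
have grow n : (N0.+1 <= n)%N -> k0 <= s n * n%:R `^ (2 * rho0).
  by move=> Nn; exact: (powR_lower_recurrence p01 lowS Nn (ltW sN)).
have arith (pw a2 h x : R) : pw * a2 * h <= k0 / 4 -> k0 <= x * pw ->
    k0 / 4 <= pw * (2^-1 * x - a2 * h).
  rewrite (_ : pw * (2^-1 * x - a2 * h) = x * pw / 2 - pw * a2 * h); last by field.
  by move: (pw * a2 * h) (x * pw) => y z; lra.
pose CH := `|quad v^T T| + 1.
have CH0 : 0 < CH by rewrite ltr_wpDl.
have near_H : \forall n \near \oo, msq Pr v^T (H n) <= CH.
  apply: (cvgr_le _ (Hbound v^T)); rewrite /CH.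
  by rewrite (le_lt_trans (ler_norm _))// ltrDl.
have near_a : \forall n \near \oo, step_size n <= k0 / (4 * CH).
  by apply: (cvgr_le _ sz); rewrite divr_gt0// mulr_gt0.
apply: (@cvg0_no_faster_than_real _ _ _ (k0 / 4 / C)).
- by rewrite !divr_gt0.
- by move=> n; exact: mean_square_ge0.
- under eq_fun do rewrite mean_squareE.
  have := @cvg_sum_real R 'I_d (index_enum 'I_d) _ _ (fun i => th0 (delta_mx 0 i)).
  by rewrite big1.
near=> n.
have n0 : (0 < n)%N by near: n; exact: nbhs_infty_gt.
have n0R : 0 < n%:R :> R by rewrite ltr0n.
have hH : msq Pr v^T (H n) <= CH by near: n.
have ha : step_size n <= k0 / (4 * CH) by near: n.
have hs : k0 <= s n * n%:R `^ (2 * rho0).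
  by apply: grow; near: n; exact: nbhs_infty_gt.
have np : n%:R `^ (2 * rho0) * step_size n ^+ 2 <= step_size n.
  have np1 : n%:R `^ (2 * rho0) <= n%:R.
    rewrite -[leRHS]powRr1 ?ler0n// ler_powR ?ler1n//.
    by case/andP: p01 => _ /ltW.
  apply: (le_trans (ler_wpM2r (sqr_ge0 _) np1)).
  by rewrite /step_size expr2 mulrA divff ?gt_eqF// mul1r.
have a0 : 0 <= step_size n :> R := step_size_ge0 n.
have p0 : 0 <= n%:R `^ (2 * rho0) := powR_ge0 _ _.
have h1 : n%:R `^ (2 * rho0) * step_size n ^+ 2 * msq Pr v^T (H n) <= k0 / 4.
  apply: (le_trans (ler_wpM2l (mulr_ge0 p0 (sqr_ge0 _)) hH)).
  apply: (le_trans (ler_wpM2r (ltW CH0) np)).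
  apply: (le_trans (ler_wpM2r (ltW CH0) ha)).
  by rewrite le_eqVlt; apply/orP; left; apply/eqP; field; rewrite gt_eqF.
rewrite ler_pdivrMr// -[leRHS]mulrA [_ * C]mulrC.
apply: le_trans (ler_wpM2l p0 (leC (th n) (sth n))).
apply: le_trans (ler_wpM2l p0 (c_le v^T n)).
exact: (arith _ _ _ _ h1 hs).
Unshelve. all: by end_near. Qed.
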